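(* Let $m,n,d,a,b$ denote integers. The following matroid dualities hold. (1) For $0\le d\le n$, the symmetric power matroid $\mathrm{S}_n(n-d,0)$ is dual to the symmetric matrix completion matroid $\mathcal{S}_n(d)$. (2) For $0\le d\le n$, the wedge power matroid $\mathrm{W}_n(n-d,0)$ is dual to the hyperconnectivity matroid $\mathcal{H}_n(d)$. (3) For $0\le a\le m$ and $0\le b\le n$, the tensor matroid $\mathrm{T}_{m,n}(m-a,n-b,0)$ is dual to the bipartite rigidity matroid $\mathcal{B}_{m,n}(a,b)$.
   Context: Write $[n]=\{1,\dots,n\}$ and let $\binom{[n]}{2}$ be the set of 2-element subsets of $[n]$. The dual of a matroid $M$ is the matroid on the same ground set whose bases are the complements of the bases of $M$. Linear algebraic matroids. Let $p$ be $0$ or a prime, and let $K$ be a field of characteristic $p$. Let $0\le r\le n$ and let $v_1,\dots,v_n\in K^r$ be vectors all of whose coordinates are algebraically independent over the prime field. - $\mathrm{S}_n(r,p)$ is the matroid on $\binom{[n]}{2}\sqcup[n]$ represented by the vectors $v_iv_j\in \operatorname{Sym}^2K^r$ (for $\{i,j\}\in\binom{[n]}{2}$) and $v_i^2\in\operatorname{Sym}^2K^r$ (for $i\in[n]$). - $\mathrm{W}_n(r,p)$ is the matroid on $\binom{[n]}{2}$ represented by the vectors $v_i\wedge v_j\in\wedge^2K^r$, $i<j$. - If $0\le s\le m$ and $u_1,\dots,u_m\in K^s$ are such that all coordinates of the $u_i$ and $v_j$ together are algebraically independent over the prime field, $\mathrm{T}_{m,n}(s,r,p)$ is the matroid on $[m]\times[n]$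 represented by the vectors $u_i\otimes v_j\in K^s\otimes K^r$. These matroids depend only on the indicated parameters. Symmetric matrix completion matroid. For $0\le d\le n$, $\mathcal{S}_n(d)$ is the matroid on $\binom{[n]}{2}\sqcup[n]$ in which a subset is independent if and only if the corresponding coordinate functions $x_{ij}$, $i\le j$ (with $\{i,j\}\in\binom{[n]}{2}$ corresponding to the $(i,j)$ entry and $i\in[n]$ to the $(i,i)$ entry), are algebraically independent over $\mathbb{C}$ in the field of rational functions on the variety of $n\times n$ symmetric complex matrices of rank at most $d$. Hyperconnectivity matroid. For $0\le d\le n$, $\mathcal{H}_n(d)$ is the column matroid of the following $nd\times\binom n2$ matrix over $\mathbb{C}(x_{ij})_{1\le i\le n,1\le j\le d}$. Rows are labeled by $(i,j)\in[n]\times[d]$ and columns by $\binom{[n]}{2}$. The row $(i,j)$ has entry $x_{kj}$ in the column $\{k,i\}$ if $k<i$, entry $-x_{kj}$ in the column $\{k,i\}$ if $k>i$, and $0$ in all other columns. Bipartite rigidity matroid. For $0\le a\le m$, $0\le b\le n$, $\mathcal{B}_{m,n}(a,b)$ is the column matroid of the following $(an+bm)\times mn$ matrix over $\mathbb{C}(x_{ij},y_{k\ell})_{(i,j)\in[m]\times[a],\,(k,\ell)\in[n]\times[b]}$. Columns are labeled by $[m]\times[n]$; rows are labeled by elements of $[a]\times[n]$ or of $[b]\times[m]$. The row labeled $(j,k)\in[a]\times[n]$ has $x_{ij}$ in the column $(i,k)$ for each $i\in[m]$ and $0$ in every other column. The row labeled $(\ell,i)\in[b]\times[m]$ has $y_{q\ell}$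 in the column $(i,q)$ for each $q\in[n]$ and $0$ in every other column. *)

(* Defs.v *)
From HB Require Import structures.
From mathcomp Require Import all_boot all_order all_algebra.
From mathcomp Require Import generic_quotient ring_quotient fraction.
From mathcomp Require Import mpoly complex boolp reals.
From mathcomp Require Import zify.

Set Implicit Arguments.
Unset Strict Implicit.
Unset Printing Implicit Defensive.

Import GRing.Theory Num.Theory.
Local Open Scope ring_scope.

Section Matroid.
Variable E : finType.
Implicit Types (M N : {set E} -> Prop) (A B : {set E}).

Definition is_matroid M : Prop :=
  [/\ M set0,
      forall A B, A \subset B -> M B -> M A &
      forall A B, M A -> M B -> (#|A| < #|B|)%N ->
        exists2 e, e \in B :\: A & M (e |: A)].

Definition basis M B : Prop := M B /\ forall A, M A -> B \subset A -> A = B.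

Definition dual_matroids M N : Prop :=
  [/\ is_matroid M, is_matroid N & forall B, basis M B <-> basis N (~: B)].

End Matroid.

(* Independence is that of the family (v e), so repeated vectors are
   dependent. *)
Definition linear_matroid (K : fieldType) (V : lmodType K) (E : finType)
    (v : E -> V) : {set E} -> Prop :=
  fun A => forall c : E -> K,
    \sum_(e in A) c e *: v e = 0 -> forall e, e \in A -> c e = 0.

(* The matrix has rows labelled by T and columns labelled by E. *)
Definition column_matroid (K : fieldType) (T E : finType) (M : T -> E -> K) :
    {set E} -> Prop :=
  linear_matroid (fun e => [ffun t => M t e] : {ffun T -> K^o}).

(* Algebraic independence, over the image of F in L under iota, of the family
   (x e) indexed by the e in A. *)
Definition algebraic_matroid (F L : fieldType) (iota : F -> L) (E : finType)
    (x : E -> L) : {set E} -> Prop :=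
  fun A => forall p : {mpoly F[#|A|]},
    mmap iota (fun k : 'I_#|A| => x (enum_val k)) p = 0 -> p = 0.

(* For K of characteristic 0, ratr embeds rat as the prime field of K. *)
Definition generic_over_rat (K : fieldType) (T : finType) (x : T -> K) : Prop :=
  algebraic_matroid (ratr : rat -> K) x [set: T].

(* The 2-element subset {i, j} of 'I_n is encoded by the pair (i, j), i < j. *)
Definition pairs n : Type := {e : 'I_n * 'I_n | (e.1 < e.2)%N}.
HB.instance Definition _ n := Finite.on (pairs n).

Section PowerMatroids.
Variable K : fieldType.

(* Sym^2 K^r is the degree 2 part of K[X_1, ..., X_r], where K^r is the space
   of linear forms. *)
Definition linform r (v : 'rV[K]_r) : {mpoly K[r]} := \sum_(k < r) v 0 k *: 'X_k.

Definition sym_matroid n r (v : 'I_n -> 'rV[K]_r) : {set pairs n + 'I_n} -> Prop :=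
  linear_matroid (fun e => match e with
    | inl e => linform (v (val e).1) * linform (v (val e).2)
    | inr i => linform (v i) ^+ 2
    end).

(* K^s (x) K^r is the space of s x r matrices. *)
Definition tensor s r (u : 'rV[K]_s) (v : 'rV[K]_r) : 'M[K]_(s, r) := u^T *m v.

(* wedge^2 K^r is the space of alternating matrices, e_k /\ e_l being
   E_kl - E_lk; this is an isomorphism in every characteristic. *)
Definition wedge r (u v : 'rV[K]_r) : 'M[K]_r := tensor u v - tensor v u.

Definition wedge_matroid n r (v : 'I_n -> 'rV[K]_r) : {set pairs n} -> Prop :=
  linear_matroid (fun e => wedge (v (val e).1) (v (val e).2)).

Definition tensor_matroid m n s r (u : 'I_m -> 'rV[K]_s) (v : 'I_n -> 'rV[K]_r) :
    {set 'I_m * 'I_n} -> Prop :=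
  linear_matroid (fun e => tensor (u e.1) (v e.2)).

Definition coords n r (v : 'I_n -> 'rV[K]_r) : 'I_n * 'I_r -> K :=
  fun c => v c.1 0 c.2.

Definition coords2 m n s r (u : 'I_m -> 'rV[K]_s) (v : 'I_n -> 'rV[K]_r) :
    'I_m * 'I_s + 'I_n * 'I_r -> K :=
  fun c => match c with inl c => coords u c | inr c => coords v c end.

End PowerMatroids.

Section PrimeQuotient.
Variables (A : comNzRingType) (I : prime_idealr A).
Local Notation Q := (Quotient.quot I).

Definition quot_unit : pred Q := fun x => `[< exists y, y * x = 1 >].

Definition quot_inv (x : Q) : Q :=
  match pselect (exists y, y * x = 1) with
  | left h => projT1 (cid h)
  | right _ => x
  end.

Lemma quot_mulVx : {in quot_unit, left_inverse 1 quot_inv *%R}.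
Proof.
move=> x /asboolP h; rewrite /quot_inv; case: pselect => // h'.
by case: (cid h').
Qed.

Lemma quot_unitPl x y : y * x = 1 -> quot_unit x.
Proof. by move=> xy; apply/asboolP; exists y. Qed.

Lemma quot_inv_out : {in [predC quot_unit], quot_inv =1 id}.
Proof.
by move=> x /asboolP nx; rewrite /quot_inv; case: pselect.
Qed.

HB.instance Definition _ := GRing.ComNzRing_hasMulInverse.Build Q
  quot_mulVx quot_unitPl quot_inv_out.
HB.instance Definition _ := GRing.ComUnitRing_isIntegral.Build Q
  (@Quotient.rquot_IdomainAxiom A I).

End PrimeQuotient.

Section SymmetricCompletion.
Variables (R : realType) (n d : nat).
Local Notation C := R[i].

Definition sym_variety (M : 'M[C]_n) : Prop := M^T = M /\ (\rank M <= d)%N.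

(* The affine space of n x n matrices has coordinate ring {mpoly C[n * n]},
   the (i, j) entry being the variable of index mxvec_index i j. *)
Definition eval_mx (M : 'M[C]_n) (p : {mpoly C[n * n]}) : C :=
  p.@[fun k => mxvec M 0 k].

Definition sym_ideal : {pred {mpoly C[n * n]}} :=
  fun p => `[< forall M, sym_variety M -> eval_mx M p = 0 >].

Lemma sym_ideal_closed : idealr_closed sym_ideal.
Proof.
split=> [||a u v /asboolP u0 /asboolP v0]; last 1 first.
- by apply/asboolP=> M XM; rewrite /eval_mx mevalD mevalM [X in _ * X]u0 //
    [X in _ + X]v0 // mulr0 addr0.
- by apply/asboolP=> M _; rewrite /eval_mx meval0.
apply/asboolP=> /(_ 0); rewrite /eval_mx meval1 => h.
have /h/eqP : sym_variety 0 by split; rewrite ?trmx0 ?mxrank0.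
by rewrite oner_eq0.
Qed.

HB.instance Definition _ :=
  isIdealr.Build {mpoly C[n * n]} sym_ideal sym_ideal_closed.

End SymmetricCompletion.

Lemma sym_anisotropic (R : realType) n (M : 'M[R[i]]_n) :
  M^T = M -> M != 0 -> exists w : 'cV_n, (w^T *m M *m w) 0 0 != 0.
Proof.
move=> sM nzM; apply: contrapT => H; case/eqP: nzM.
have q (w : 'cV_n) : w^T *m M *m w = 0.
  apply: contrapT => h; apply: H; exists w; apply/eqP => h0; apply: h.
  by apply/matrixP => i j; rewrite !ord1 h0 mxE.
apply/matrixP=> i j; rewrite mxE.
have b : (delta_mx i 0)^T *m M *m delta_mx j 0 = const_mx (M i j) :> 'M_1.
  rewrite trmx_delta -rowE -colE; apply/matrixP=> k l.
  by rewrite !ord1 !mxE.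
have b' : (delta_mx j 0)^T *m M *m delta_mx i 0 = const_mx (M i j) :> 'M_1.
  rewrite trmx_delta -rowE -colE; apply/matrixP=> k l.
  by rewrite !ord1 !mxE -[in LHS]sM mxE.
have := q (delta_mx i 0 + delta_mx j 0).
rewrite [(_ + _)^T]linearD /= mulmxDl mulmxDr !mulmxDl !q b b' add0r addr0.
move=> /matrixP/(_ 0 0); rewrite !mxE => /eqP.
by rewrite -mulr2n mulrn_eq0 /= => /eqP.
Qed.

Lemma sym_varietyP (R : realType) n d (M : 'M[R[i]]_n) :
  sym_variety d M -> exists Y : 'M_(n, d), M = Y *m Y^T.
Proof.
elim: d M => [|d IHd] M [sM rM].
  exists 0; rewrite mul0mx; apply/eqP.
  by rewrite -mxrank_eq0 -leqn0.
have [->|nzM] := eqVneq M 0; first by exists 0; rewrite mul0mx.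
have [w nzc] := sym_anisotropic sM nzM.
set c := (_ *m w) 0 0 in nzc; pose s := sqrtc c.
have ss : s * s = c by rewrite -expr2 sqr_sqrtc.
have nzs : s != 0 by rewrite sqrtc_eq0.
have wMw : w^T *m M *m w = c%:M.
  by apply/matrixP => i j; rewrite !ord1 [RHS]mxE.
pose v := s^-1 *: (M *m w).
have vT : v^T = s^-1 *: (w^T *m M) by rewrite linearZ /= trmx_mul sM.
pose M' := M - v *m v^T.
have sM' : M'^T = M' by rewrite linearB /= trmx_mul trmxK sM.
have wM' : w^T *m M' = 0.
  rewrite mulmxBr mulmxA -scalemxAr !mulmxA wMw vT -scalemxAl -scalemxAr.
  by rewrite mul_scalar_mx !scalerA -ss mulKf // mulVf // scale1r subrr.
have [] := IHd M'.
  split=> //; rewrite -ltnS; apply: leq_trans rM.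
  have : (kermx M < kermx M')%MS.
    rewrite /ltmx; apply/andP; split.
      apply/sub_kermxP; rewrite mulmxBr mulmx_ker mulmxA -scalemxAr mulmxA.
      by rewrite mulmx_ker mul0mx scaler0 mul0mx subrr.
    apply/negP => /(submx_trans (_ : (w^T <= kermx M')%MS)).
    move=> /(_ (introT sub_kermxP wM'))/sub_kermxP h.
    by case/eqP: nzc; rewrite /c h mul0mx mxE.
  rewrite ltmxErank => /andP[_]; rewrite !mxrank_ker.
  by have := rank_leq_row M; have := rank_leq_row M'; lia.
move=> Y defM'.
have defM : row_mx v Y *m (row_mx v Y)^T = M.
  by rewrite tr_row_mx mul_row_col -defM' addrC subrK.
by exists (row_mx v Y : 'M_(n, 1 + d)); rewrite -[LHS]defM.
Qed.

Lemma horner_mmap (K : fieldType) N (h : 'I_N -> {poly K}) (p : {mpoly K[N]}) t :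
  (mmap polyC h p).[t] = p.@[fun k => (h k).[t]].
Proof.
rewrite mevalE /mmap horner_sum; apply: eq_bigr => m _.
rewrite hornerCM; congr (_ * _); rewrite /mmap1 horner_prod.
by apply: eq_bigr => k _; rewrite horner_exp.
Qed.

Lemma poly_fun0 (K : numFieldType) (p : {poly K}) : (forall t, p.[t] = 0) -> p = 0.
Proof.
move=> p0; apply: (@roots_geq_poly_eq0 _ p [seq k%:R | k <- iota 0 (size p)]).
- by apply/allP => t _; apply/rootP.
- by rewrite map_inj_uniq ?iota_uniq //; apply: (mulrIn (oner_neq0 K)).
- by rewrite size_map size_iota.
Qed.

Section SymmetricCompletionField.
Variables (R : realType) (n d : nat).
Local Notation C := R[i].

Lemma sym_ideal_prime : prime_idealr_closed (@sym_ideal R n d).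
Proof.
move=> p q /asboolP pq0; apply/orP; apply: contrapT => npq.
have [A [XA pA]] : exists A, sym_variety d A /\ eval_mx A p <> 0.
  apply: contrapT => h; apply: npq; left; apply/asboolP => M XM.
  by apply: contrapT => pM; apply: h; exists M.
have [B [XB qB]] : exists B, sym_variety d B /\ eval_mx B q <> 0.
  apply: contrapT => h; apply: npq; right; apply/asboolP => M XM.
  by apply: contrapT => pM; apply: h; exists M.
have [Y defA] := sym_varietyP XA; have [Z defB] := sym_varietyP XB.
pose L : 'M[{poly C}]_(n, d) := map_mx polyC Y + 'X *: map_mx polyC (Z - Y).
pose G := L *m L^T; pose ev := mmap polyC (fun k => mxvec G 0 k).
pose Lt t := Y + t *: (Z - Y).
have evE t r : (ev r).[t] = eval_mx (Lt t *m (Lt t)^T) r.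
  rewrite horner_mmap; apply: meval_eq => k; case/mxvec_indexP: k => i j.
  rewrite !mxvecE !mxE horner_sum; apply: eq_bigr => k _.
  by rewrite !mxE !hornerE.
have XL t : sym_variety d (Lt t *m (Lt t)^T).
  split; first by rewrite trmx_mul trmxK.
  by rewrite (leq_trans (mxrankM_maxl _ _)) ?rank_leq_col.
have : ev p * ev q = 0.
  apply: poly_fun0 => t; rewrite hornerM !evE /eval_mx -mevalM.
  exact: pq0 (XL t).
move=> /eqP; rewrite mulf_eq0 => /orP[]/eqP h.
  by apply: pA; rewrite -(horner0 0) -h evE /Lt scale0r addr0 defA.
by apply: qB; rewrite -(horner0 1) -h evE /Lt scale1r addrC subrK defB.
Qed.

HB.instance Definition _ := isPrimeIdealrClosed.Build {mpoly C[n * n]}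
  (@sym_ideal R n d) sym_ideal_prime.

Definition sym_coordinate_ring : idomainType :=
  Quotient.quot (@sym_ideal R n d : prime_idealr {mpoly C[n * n]}).

Definition sym_function_field : fieldType := {fraction sym_coordinate_ring}.

Definition restrict_to_variety (p : {mpoly C[n * n]}) : sym_function_field :=
  tofrac (\pi_sym_coordinate_ring%qT p).

Definition coordinate_function (e : pairs n + 'I_n) : sym_function_field :=
  match e with
  | inl e => restrict_to_variety 'X_(mxvec_index (val e).1 (val e).2)
  | inr i => restrict_to_variety 'X_(mxvec_index i i)
  end.

Definition sym_completion_matroid : {set pairs n + 'I_n} -> Prop :=
  algebraic_matroid (fun c : C => restrict_to_variety c%:MP) coordinate_function.

End SymmetricCompletionField.

Section Rigidity.
Variable R : realType.
Local Notation C := R[i].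

Definition hyper_field n d : fieldType := {fraction {mpoly C[n * d]}}.

Definition hyper_var n d (i : 'I_n) (j : 'I_d) : hyper_field n d :=
  tofrac 'X_(mxvec_index i j).

Definition hyper_matrix n d (row : 'I_n * 'I_d) (col : pairs n) : hyper_field n d :=
  let: (i, j) := row in let: (k, l) := val col in
  if i == l then hyper_var k j else if i == k then - hyper_var l j else 0.

Definition hyperconnectivity_matroid n d : {set pairs n} -> Prop :=
  column_matroid (@hyper_matrix n d).

Definition birigid_field m n a b : fieldType :=
  {fraction {mpoly C[m * a + n * b]}}.

Definition birigid_x m n a b (i : 'I_m) (j : 'I_a) : birigid_field m n a b :=
  tofrac 'X_(lshift (n * b) (mxvec_index i j)).

Definition birigid_y m n a b (k : 'I_n) (l : 'I_b) : birigid_field m n a b :=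
  tofrac 'X_(rshift (m * a) (mxvec_index k l)).

Definition birigid_matrix m n a b (row : 'I_a * 'I_n + 'I_b * 'I_m)
    (col : 'I_m * 'I_n) : birigid_field m n a b :=
  match row with
  | inl (j, k) => if col.2 == k then birigid_x n b col.1 j else 0
  | inr (l, i) => if col.1 == i then birigid_y m a col.2 l else 0
  end.

Definition birigidity_matroid m n a b : {set 'I_m * 'I_n} -> Prop :=
  column_matroid (@birigid_matrix m n a b).

End Rigidity.

(* Main.v *)
From HB Require Import structures.
Require Import Defs.
From mathcomp Require Import all_boot all_order all_algebra.
From mathcomp Require Import generic_quotient ring_quotient fraction.
From mathcomp Require Import mpoly complex boolp reals zify.
(* mpoly has its own [basis] *)
Import Defs.

Set Implicit Arguments.
Unset Strict Implicit.
Unset Printing Implicit Defensive.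

Import GRing.Theory Num.Theory.
Local Open Scope ring_scope.

(* Over one field: if the column spaces of V and X are orthogonal complements,
   the linear relations among the v_i v_j (v_i /\ v_j, u_i (x) v_j) are exactly
   the matrices A X^T + X A^T (X A^T - A X^T, X P + Q Y^T), that is, the row
   space of the matrix defining the other matroid; so the two are dual.

   Across fields: a minor that is nonzero at some point is nonzero at a generic
   point over any field of characteristic 0.  Hence independence passes from the
   orthogonal complement of a generic matrix to a generic matrix over another
   field, and the ranks agree because all matrices of full rank give the same
   one.

   The algebraic matroid of symmetric completion is parametrized by X X^T, so by
   the Jacobian criterion it is the linear matroid of the differentials of the
   entries of X X^T. *)

(** * Bases and duality *)

(** The orthogonal complement of a generic matrix need not have algebraically independent entries:
    the transcendence degree of [K] may already be used up. Hence four matroids are compared: each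
    generic one is exactly dual to a complementary one over its own field. Only one half of
    semicontinuity is then needed, that independence at a special point implies independence at a
    generic point, together with equality of ranks. The entries of every matrix involved are
    polynomials with integer coefficients in the coordinates, so the same matrix can be evaluated in
    two unrelated fields. Division by 2 enters when a solution of a symmetric or alternating
    equation is averaged with its transpose. *)

Section MatroidTheory.
Variable E : finType.
Implicit Types (M N : {set E} -> Prop) (A B : {set E}).

Lemma matroid_le_basis M A B :
  is_matroid M -> M A -> basis M B -> (#|A| <= #|B|)%N.
Proof.
move=> [_ _ aug] MA [MB maxB]; rewrite leqNgt; apply/negP => /(aug _ _ MB MA).
case=> e /setDP[_ eB] /maxB/(_ (subsetUr _ _)) eqB.
by case/negP: eB; rewrite -eqB setU11.
Qed.

Lemma matroid_card_basis M A B :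
  is_matroid M -> M A -> basis M B -> (#|B| <= #|A|)%N -> basis M A.
Proof.
move=> mM MA bB leBA; split=> // C MC sAC; apply/eqP; rewrite eq_sym.
by rewrite eqEcard sAC (leq_trans (matroid_le_basis mM MC bB)).
Qed.

Lemma matroid_basis_sup M A : M A -> exists2 B, basis M B & A \subset B.
Proof.
move=> MA; have MA' : (fun B => `[< M B >]) A by apply/asboolP.
have [B /maxsetP[/asboolP MB maxB] sAB] := maxset_exists (P := fun B => `[< M B >]) MA'.
exists B => //; split=> // C MC sBC.
by apply: maxB => //; apply/asboolP.
Qed.

(* M, N are generic and M', N' special: the complement of a basis of M is a
   basis of N', hence independent in N, where equality of ranks makes it a
   basis. *)
Lemma dual_matroids_transfer M M' N N' :
    dual_matroids M N' -> dual_matroids M' N ->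
    (forall A, M' A -> M A) -> (forall A, N' A -> N A) ->
    (forall A B, basis M A -> basis M' B -> #|A| = #|B|) ->
  dual_matroids M N.
Proof.
move=> [mM _ MN'] [mM' mN M'N] sM sN eqc; split=> // B.
have cardC (A : {set E}) : (#|A| + #|~: A| = #|E|)%N by rewrite cardsC.
split=> bB.
  have [M'0 _ _] := mM'; have [B' bB' _] := matroid_basis_sup M'0.
  apply: (@matroid_card_basis N _ (~: B')) => //.
  - by apply: sN; case/MN': bB.
  - exact/M'N.
  - by have := eqc _ _ bB bB'; have := cardC B; have := cardC B'; lia.
have [M0 _ _] := mM; have [B' bB' _] := matroid_basis_sup M0.
have bB2 : basis M' B by apply/M'N.
apply: (matroid_card_basis mM _ bB'); first by apply: sM; case: bB2.
by rewrite (eqc _ _ bB' bB2).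
Qed.

End MatroidTheory.

(** * Linear matroids: spans, exchange, rank *)

Section LinearMatroid.
Variables (K : fieldType) (V : lmodType K).

Definition inspan (I : finType) (A : {set I}) (v : I -> V) (x : V) : Prop :=
  exists c : I -> K, x = \sum_(i in A) c i *: v i.

Section Span.
Variables (I : finType) (A : {set I}) (v : I -> V).

Lemma inspan_mem i : i \in A -> inspan A v (v i).
Proof.
move=> iA; exists (fun j => (j == i)%:R); rewrite (bigD1 i) //= eqxx scale1r.
by rewrite big1 ?addr0 // => j /andP[_ /negbTE->]; rewrite scale0r.
Qed.

Lemma inspanZ a x : inspan A v x -> inspan A v (a *: x).
Proof.
move=> [c ->]; exists (fun i => a * c i); rewrite scaler_sumr.
by apply: eq_bigr => i _; rewrite scalerA.
Qed.

Lemma inspan0 : inspan A v 0.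
Proof. by exists (fun=> 0); rewrite big1 // => i _; rewrite scale0r. Qed.

Lemma inspanD x y : inspan A v x -> inspan A v y -> inspan A v (x + y).
Proof.
move=> [c ->] [c' ->]; exists (fun i => c i + c' i).
by rewrite -big_split; apply: eq_bigr => i _; rewrite scalerDl.
Qed.

Lemma inspan_sum (J : Type) (r : seq J) (P : pred J) (x : J -> V) :
  (forall j, P j -> inspan A v (x j)) -> inspan A v (\sum_(j <- r | P j) x j).
Proof.
by move=> h; elim/big_ind: _ => //; [exact: inspan0 | exact: inspanD].
Qed.

End Span.

Lemma inspan_trans (I J : finType) (A : {set I}) (B : {set J}) v w x :
    (forall i, i \in A -> inspan B w (v i)) -> inspan A v x ->
  inspan B w x.
Proof. by move=> vw [c ->]; apply: inspan_sum => i iA; apply/inspanZ/vw. Qed.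

Lemma linear_matroid_enum (I : finType) (A : {set I}) (v : I -> V) :
  linear_matroid v A <->
  forall y : 'I_#|A| -> K, \sum_k y k *: v (enum_val k) = 0 -> forall k, y k = 0.
Proof.
split=> [indA y y0 k | indA c].
  pose c i := \sum_k (enum_val k == i)%:R * y k.
  have cE l : c (enum_val l) = y l.
    rewrite /c (bigD1 l) //= eqxx mul1r big1 ?addr0 // => j nj.
    by rewrite (inj_eq enum_val_inj) (negbTE nj) mul0r.
  rewrite -cE; apply: indA (enum_valP k); rewrite big_enum_val -[RHS]y0.
  by apply: eq_bigr => l _; rewrite cE.
rewrite big_enum_val => /indA c0 e eA.
by rewrite -(enum_rankK_in eA eA) c0.
Qed.

(** The matrix of coefficients of the [v i] in terms of the [w j] has trivial left kernel, since a
    kernel vector would be a relation among the [v i]. So its rank, the number of its rows, is at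
    most the number of its columns. *)
Lemma steinitz (I J : finType) (A : {set I}) (B : {set J}) v w :
    linear_matroid v A -> (forall i, i \in A -> inspan B w (v i)) ->
  (#|A| <= #|B|)%N.
Proof.
move=> /linear_matroid_enum indA spanA.
have /choice[c hc] (k : 'I_#|A|) := spanA _ (enum_valP k).
pose M := \matrix_(i < #|A|, j < #|B|) c i (enum_val j).
suff /eqP <- : row_free M by apply: rank_leq_col.
apply: inj_row_free => y yM; apply/rowP => k; rewrite mxE.
apply: indA k; under eq_bigr do rewrite hc big_enum_val scaler_sumr.
rewrite exchange_big big1 //= => j _.
under eq_bigr do rewrite scalerA.
move/rowP/(_ j): yM; rewrite !mxE -scaler_suml => yM.
rewrite [X in X *: _](_ : _ = 0) ?scale0r // -[RHS]yM.
by apply: eq_bigr => i _; rewrite mxE.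
Qed.

Section Family.
Variables (E : finType) (v : E -> V).
Implicit Types A B : {set E}.

Lemma linear_matroidU A e :
  linear_matroid v A -> ~ linear_matroid v (e |: A) -> inspan A v (v e).
Proof.
have [eA _ _|neA indA ndep] := boolP (e \in A); first exact: inspan_mem.
have [c [c0 [f]]] : exists c : E -> K,
    \sum_(i in e |: A) c i *: v i = 0 /\ exists f, f \in e |: A /\ c f <> 0.
  apply: contrapT => h; apply: ndep => c c0 f fA.
  by apply: contrapT => cf; apply: h; exists c; split=> //; exists f.
move: c0; rewrite big_setU1 //= => c0 [fA cf].
have nce : c e != 0.
  apply/eqP => ce; move: c0; rewrite ce scale0r add0r => /indA h.
  by case/setU1P: fA => [fe|/h //]; apply: cf; rewrite fe.
exists (fun i => - (c e)^-1 * c i).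
apply: (scalerI nce); move/eqP: c0; rewrite addr_eq0 => /eqP->.
rewrite scaler_sumr -sumrN; apply: eq_bigr => i _.
by rewrite scalerA mulrA mulrN mulfV // mulN1r scaleNr.
Qed.

Lemma linear_matroid_is_matroid : is_matroid (linear_matroid v).
Proof.
split=> [c _ e|A B sAB indB c c0 e eA|A B indA indB ltAB].
- by rewrite inE.
- pose c' i := if i \in A then c i else 0.
  have <- : c' e = c e by rewrite /c' eA.
  apply: indB (subsetP sAB _ eA); rewrite (big_setID A) /= (setIidPr sAB).
  rewrite [X in _ + X]big1 ?addr0 => [|i /setDP[_ /negbTE iA]]; last first.
    by rewrite /c' iA scale0r.
  by rewrite -[RHS]c0; apply: eq_bigr => i iA; rewrite /c' iA.
(* If no element of [B] could be added to [A], all of [B] would lie in the span of [A], against the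
   exchange bound. *)
- apply: contrapT => h; move: ltAB; rewrite ltnNge => /negP; apply.
  apply: (steinitz indB) => i iB.
  have [iA|niA] := boolP (i \in A); first exact: inspan_mem.
  by apply: (linear_matroidU indA) => hi; apply: h; exists i => //; apply/setDP.
Qed.

Lemma basis_inspan B e : basis (linear_matroid v) B -> inspan B v (v e).
Proof.
move=> [indB maxB]; have [eB|neB] := boolP (e \in B); first exact: inspan_mem.
apply: linear_matroidU => // /maxB/(_ (subsetUr _ _)) eqB.
by case/negP: neB; rewrite -eqB setU11.
Qed.

(** Computes a rank from any independent family [w] with the same span; this makes the rank
    independent of the chosen point. *)
Lemma card_basis_span (F : finType) (w : F -> V) B :
    linear_matroid w [set: F] -> (forall f, inspan [set: E] v (w f)) ->
    (forall e, inspan [set: F] w (v e)) -> basis (linear_matroid v) B ->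
  #|B| = #|F|.
Proof.
move=> indF Fv vF bB; apply/eqP; rewrite eqn_leq -cardsT.
rewrite (steinitz bB.1 (fun e _ => vF e)) //=.
apply: steinitz indF _ => f _; apply: inspan_trans (Fv f) => e _.
exact: basis_inspan.
Qed.

Lemma linear_matroid_scale (s : E -> K) :
  (forall e, s e != 0) -> linear_matroid (fun e => s e *: v e) = linear_matroid v.
Proof.
move=> nzs; apply/funext => A; apply/propext; split=> indA c c0 e eA.
  suff /eqP : c e / s e = 0 by rewrite mulf_eq0 invr_eq0 (negbTE (nzs e)) orbF => /eqP.
  apply: (indA (fun e => c e / s e)) => //; rewrite -[RHS]c0.
  by apply: eq_bigr => i _; rewrite scalerA divfK.
apply: (mulIf (nzs e)); rewrite mul0r.
apply: (indA (fun e => c e * s e)) => //; rewrite -[RHS]c0.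
by apply: eq_bigr => i _; rewrite scalerA.
Qed.

Lemma linear_matroidT :
  linear_matroid v [set: E] <->
  (forall c : E -> K, \sum_e c e *: v e = 0 -> forall e, c e = 0).
Proof.
split=> [indT c c0 e | indT c c0 e _].
  by apply: (indT c); rewrite ?inE // -[RHS]c0; apply: eq_bigl => ?; rewrite inE.
by apply: indT; rewrite -[RHS]c0; apply: eq_bigl => ?; rewrite inE.
Qed.

End Family.
End LinearMatroid.

(** * Column matroids and row spaces *)

Section Columns.
Variables (K : fieldType) (E : finType).

Section OneMatrix.
Variables (T : finType) (M : T -> E -> K).

(** Coefficients range over all of [E], and support in a subset is expressed by vanishing elsewhere;
    so relations can be compared with row vectors of another matrix. *)
Definition relation (c : E -> K) : Prop := forall t, \sum_e c e * M t e = 0.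

Lemma sum_columns (A : {set E}) (c : E -> K) t :
  (\sum_(e in A) c e *: ([ffun t => M t e] : {ffun T -> K^o})) t =
  \sum_(e in A) c e * M t e.
Proof. by rewrite sum_ffunE; apply: eq_bigr => e _; rewrite !ffunE. Qed.

Lemma column_matroidP (A : {set E}) :
  column_matroid M A <->
  (forall c : E -> K, (forall e, e \notin A -> c e = 0) -> relation c ->
    forall e, c e = 0).
Proof.
split=> indA c.
  move=> cA rc e; have [eA|/cA//] := boolP (e \in A).
  apply: indA (eA); apply/ffunP => t; rewrite sum_columns ffunE -[RHS](rc t).
  rewrite [RHS](bigID (mem A)) /= [X in _ = _ + X]big1 ?addr0 // => i /cA->.
  by rewrite mul0r.
move=> /ffunP c0 e eA; pose c' i := if i \in A then c i else 0.
have <- : c' e = c e by rewrite /c' eA.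
apply: indA => [i /negbTE iA|t]; first by rewrite /c' iA.
have := c0 t; rewrite sum_columns ffunE => h; rewrite -[RHS]h.
rewrite (bigID (mem A)) /= [X in _ + X]big1 ?addr0 => [|i /negbTE iA].
  by apply: eq_bigr => i iA; rewrite /c' iA.
by rewrite /c' iA mul0r.
Qed.

Definition column_mx (A : {set E}) : 'M[K]_(#|A|, #|T|) :=
  \matrix_(k, j) M (enum_val j) (enum_val k).

Lemma column_matroid_row_free (A : {set E}) :
  column_matroid M A <-> row_free (column_mx A).
Proof.
rewrite [column_matroid M A]linear_matroid_enum; split=> [ind|free y /ffunP y0 k].
  apply: inj_row_free => y /rowP yM; apply/rowP => k; rewrite mxE.
  apply: ind k; apply/ffunP => t; rewrite sum_ffunE ffunE.
  have := yM (enum_rank t); rewrite !mxE => h; rewrite -[RHS]h.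
  by apply: eq_bigr => k _; rewrite !ffunE mxE enum_rankK.
suff /rowP/(_ k) : (\row_k y k) = 0 :> 'rV_#|A| by rewrite !mxE.
apply: (row_free_inj free); rewrite mul0mx; apply/rowP => j.
have := y0 (enum_val j); rewrite sum_ffunE !ffunE !mxE => h; rewrite -[RHS]h.
by apply: eq_bigr => i _; rewrite !ffunE !mxE.
Qed.

Lemma basis_column B e : basis (column_matroid M) B ->
  exists a : E -> K, forall t, M t e = \sum_(b in B) a b * M t b.
Proof.
move=> /(@basis_inspan _ _ _ _ _ e)[a /ffunP ha]; exists a => t.
by have := ha t; rewrite sum_columns ffunE.
Qed.

End OneMatrix.

(* If the relations between the columns of M form the row space of N, a basis
   of either matroid has an independent complement in the other one; counting
   turns these complements into bases. *)
Lemma column_matroid_dual (T S : finType) (M : T -> E -> K) (N : S -> E -> K) :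
    (forall c, relation M c <-> exists y, forall e, c e = \sum_s y s * N s e) ->
  dual_matroids (column_matroid M) (column_matroid N).
Proof.
move=> relM; have mM := linear_matroid_is_matroid (fun e => [ffun t => M t e] : {ffun T -> K^o}).
have mN := linear_matroid_is_matroid (fun e => [ffun t => N t e] : {ffun S -> K^o}).
have MN B : basis (column_matroid M) B -> column_matroid N (~: B).
  move=> bB; apply/column_matroidP => c cB rc e.
  have [eB|neB] := boolP (e \in B); first by apply: cB; rewrite inE eB.
  have [a ha] := basis_column e bB.
  (* The fundamental relation of [e] with respect to [B]. It lies in the row space of [N], hence is
     orthogonal to [c]. As [c] vanishes on [B] and [r] is supported on [B] and [e], the pairing is
     [c e]. *)
  pose r i := (i == e)%:R - (if i \in B then a i else 0).
  have /relM[y hy] : relation M r.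
    move=> t; under eq_bigr do rewrite mulrBl.
    rewrite sumrB (bigD1 e) //= eqxx mul1r big1 ?addr0 => [|i /negbTE->]; last first.
      by rewrite mul0r.
    rewrite ha [X in _ - X](bigID (mem B)) /= [X in _ - (_ + X)]big1 ?addr0 => [|i /negbTE->].
      by apply/eqP; rewrite subr_eq0; apply/eqP/eq_bigr => i ->.
    by rewrite mul0r.
  have : \sum_i c i * r i = 0.
    under eq_bigr do rewrite hy mulr_sumr.
    rewrite exchange_big big1 //= => s _.
    under eq_bigr do rewrite mulrCA.
    by rewrite -mulr_sumr rc mulr0.
  rewrite (bigD1 e) //= /r eqxx (negbTE neB) subr0 mulr1 big1 ?addr0 // => i /negbTE ne.
  rewrite ne sub0r; case: ifP => iB; last by rewrite oppr0 mulr0.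
  by rewrite cB ?mul0r // inE iB.
have NM B : basis (column_matroid N) B -> column_matroid M (~: B).
  move=> bB; apply/column_matroidP => c cB /relM[y hy] e.
  (* The vector [c] is a combination of rows of [N], so it inherits every dependency among columns:
     [c e] is a combination of the values of [c] on [B], which are 0. *)
  have [a ha] := basis_column e bB.
  rewrite hy; under eq_bigr do rewrite ha mulr_sumr.
  rewrite exchange_big big1 //= => b bB'; under eq_bigr do rewrite mulrCA.
  by rewrite -mulr_sumr -hy cB ?mulr0 // inE bB'.
(* Row vectors of [N] take arbitrary values on [B]; [c z] is one that restricts to [z]. Being
   relations of [M], they are determined by their values off [A], because a relation supported on
   [A] is zero. So a space of dimension [#|B|] embeds in one of dimension [#|~: A|]. *)
have leC A B : column_matroid M A -> column_matroid N B -> (#|B| <= #|~: A|)%N.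
  move=> /column_matroidP indA /column_matroid_row_free/row_freeP[Y QY].
  pose c (z : 'rV_#|B|) e := \sum_s (\sum_l z 0 l * Y (enum_rank s) l) * N s e.
  have cB z k : c z (enum_val k) = z 0 k.
    transitivity ((z *m (column_mx N B *m Y)^T) 0 k); last by rewrite QY trmx1 mulmx1.
    rewrite /c trmx_mul mulmxA !mxE (reindex (@enum_val _ S)) /=; last first.
      by apply: onW_bij; apply: enum_val_bij.
    apply: eq_bigr => s _; rewrite !mxE enum_valK; congr (_ * _).
    by apply: eq_bigr => l _; rewrite !mxE.
  have relc z : relation M (c z) by apply/relM; exists (fun s => \sum_l z 0 l * Y (enum_rank s) l).
  pose D := \matrix_(l < #|B|, e < #|~: A|) c (delta_mx 0 l) (enum_val e).
  suff /eqP <- : row_free D by apply: rank_leq_col.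
  apply: inj_row_free => z /rowP zD; apply/rowP => k; rewrite mxE -cB.
  apply: indA (relc z) _ => e neA; have eA : e \in ~: A by rewrite inE.
  have := zD (enum_rank_in eA e); rewrite !mxE => h; rewrite -[RHS]h.
  rewrite /c [z in LHS](row_sum_delta z).
  under [RHS]eq_bigr do rewrite mxE enum_rankK_in // mulr_sumr.
  rewrite exchange_big /=; apply: eq_bigr => s _.
  under [RHS]eq_bigr do rewrite mulrA; rewrite -mulr_suml; congr (_ * _).
  rewrite -row_sum_delta; apply: eq_bigr => l _; congr (_ * _).
  rewrite (bigD1 l) //= mxE !eqxx mul1r big1 ?addr0 // => i /negbTE ni.
  by rewrite mxE ni andbF mul0r.
have cardC (A : {set E}) : (#|A| + #|~: A| = #|E|)%N by rewrite cardsC.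
have [M0 _ _] := mM; have [BM bM _] := matroid_basis_sup M0.
have [N0 _ _] := mN; have [BN bN _] := matroid_basis_sup N0.
split=> // B; split=> bB.
  apply: (matroid_card_basis mN (MN _ bB) bN).
  exact: leC bB.1 bN.1.
have := NM _ bB; rewrite setCK => iB.
apply: (matroid_card_basis mM iB bM).
have := leC _ _ bM.1 bB.1.
by have := cardC B; have := cardC BM; lia.
Qed.

End Columns.

(** * Specialization of generic points *)

Lemma rmorph_mmap (A : nzRingType) (B C : comNzRingType) k (F : {rmorphism B -> C})
    (f : A -> B) (h : 'I_k -> B) p :
  F (mmap f h p) = mmap (F \o f) (F \o h) p.
Proof.
rewrite /mmap rmorph_sum; apply: eq_bigr => m _; rewrite rmorphM /mmap1 rmorph_prod.
by congr (_ * _); apply: eq_bigr => i _; rewrite rmorphXn.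
Qed.

Lemma eq_mmap (A : nzRingType) (B : comNzRingType) k (f g : A -> B) (h h' : 'I_k -> B) p :
  f =1 g -> h =1 h' -> mmap f h p = mmap g h' p.
Proof.
move=> fg hh; apply: eq_bigr => m _; rewrite fg /mmap1.
by congr (_ * _); apply: eq_bigr => i _; rewrite hh.
Qed.

Lemma mmapXU (A : nzRingType) (B : comNzRingType) k (f : {rmorphism A -> B}) (h : 'I_k -> B) i :
  mmap f h 'X_i = h i.
Proof. by rewrite mmapX mmap1U. Qed.

(** Integer coefficients are preferred to rational ones because [intr] maps into every ring. *)
Lemma generic_int (K : fieldType) (T : finType) (x : T -> K) :
    generic_over_rat x ->
  forall p : {mpoly int[#|[set: T]|]}, mmap intr (x \o enum_val) p = 0 -> p = 0.
Proof.
move=> gx p p0; have q0 : map_mpoly (intr : int -> rat) p = 0.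
  apply: gx; rewrite -[RHS]p0 /mmap.
  rewrite (perm_big _ (msupp_map_mpoly p (intr_inj : injective (intr : int -> rat)))).
  by apply: eq_bigr => m _; rewrite mcoeff_map_mpoly ratr_int.
apply/mpolyP => m; have /(congr1 (mcoeff m)) := q0.
by rewrite mcoeff_map_mpoly !mcoeff0 => /eqP; rewrite intr_eq0 => /eqP.
Qed.

(* A nonzero maximal minor at a special point is a nonzero polynomial. *)
Lemma row_free_generic (K L : fieldType) k (x : 'I_k -> K) (z : 'I_k -> L) a b
    (Q : 'M[{mpoly int[k]}]_(a, b)) :
    (forall p : {mpoly int[k]}, mmap intr x p = 0 -> p = 0) ->
    row_free (map_mx (mmap intr z) Q) ->
  row_free (map_mx (mmap intr x) Q).
Proof.
move=> gx; rewrite /row_free -mxrank_tr => rz.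
have fz : row_full (map_mx (mmap intr z) Q)^T by [].
have := fullrowsub_unit fz; set f := fullrankfun fz.
rewrite matrix.map_trmx -map_mxsub unitmxE det_map_mx unitfE => nz.
suff : rowsub f (map_mx (mmap intr x) Q)^T \in unitmx.
  rewrite -row_full_unit /row_full => /eqP rf; rewrite -mxrank_tr eqn_leq rank_leq_col /=.
  by rewrite -{1}rf mxrankS // rowsub_sub.
rewrite matrix.map_trmx -map_mxsub unitmxE det_map_mx unitfE.
by apply: contraNN nz => /eqP/gx ->; rewrite raddf0.
Qed.

(** The universal point: a matrix defined over any commutative ring and evaluated at [gvar] has
    polynomial entries, whose value at [x] is the matrix at [x]. *)
Definition gvar (T : finType) (t : T) : {mpoly int[#|[set: T]|]} :=
  'X_(enum_rank_in (in_setT t) t).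

Lemma mmap_gvar (K : comNzRingType) (T : finType) (x : T -> K) t :
  mmap intr (x \o enum_val) (gvar t) = x t.
Proof. by rewrite mmapXU /= enum_rankK_in ?inE. Qed.

Lemma column_matroid_generic (K L : fieldType) (S T E : finType)
    (P : T -> E -> {mpoly int[#|[set: S]|]}) (x : S -> K) (z : S -> L)
    (Mx : T -> E -> K) (Mz : T -> E -> L) :
    generic_over_rat x ->
    (forall t e, Mx t e = mmap intr (x \o enum_val) (P t e)) ->
    (forall t e, Mz t e = mmap intr (z \o enum_val) (P t e)) ->
  forall A, column_matroid Mz A -> column_matroid Mx A.
Proof.
move=> gx Px Pz A; rewrite !column_matroid_row_free => fz.
rewrite (_ : column_mx Mx A = map_mx (mmap intr (x \o enum_val))
  (\matrix_(k, j) P (enum_val j) (enum_val k))); last first.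
  by apply/matrixP => i j; rewrite !mxE Px.
apply: (row_free_generic (z := z \o enum_val) (generic_int gx)).
congr (is_true (row_free _)): fz.
by apply/matrixP => i j; rewrite !mxE Pz.
Qed.

Lemma mmap_inj_vars (R : realType) k N (s : 'I_k -> 'I_N) (p : {mpoly rat[k]}) :
    injective s ->
  mmap (@mpolyC N R[i] \o ratr) (fun i => 'X_(s i)) p = 0 -> p = 0.
Proof.
move=> injs p0.
(* A left inverse of the renaming [s]: variables outside its image go to 0. What remains is [p] with
   its coefficients embedded by [ratr]. *)
pose h j : {mpoly R[i][k]} := if [pick i | s i == j] is Some i then 'X_i else 0.
have : mmap (@mpolyC k R[i]) h (mmap (@mpolyC N R[i] \o ratr) (fun i => 'X_(s i)) p) = 0.
  by rewrite p0 raddf0.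
rewrite rmorph_mmap (@eq_mmap _ _ _ _ (@mpolyC k R[i] \o ratr) _ (fun i => 'X_i)).
- move=> q0; apply/mpolyP => m; have /(congr1 (mcoeff m)) := q0.
  rewrite -/(map_mpoly ratr p) mcoeff_map_mpoly !mcoeff0 => /eqP.
  by rewrite fmorph_eq0 => /eqP.
- by move=> c /=; rewrite mmapC.
- move=> i /=; rewrite mmapXU /h; case: pickP => [j /eqP/injs->//|/(_ i)].
  by rewrite eqxx.
Qed.

Lemma generic_tofrac_vars (R : realType) (T : finType) N (g : T -> 'I_N) :
  injective g ->
  generic_over_rat (fun t => tofrac 'X_(g t) : {fraction {mpoly R[i][N]}}).
Proof.
move=> injg p p0.
apply: (@mmap_inj_vars R _ N (fun i => g (enum_val i))).
  by move=> i j /injg/enum_val_inj.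
apply/eqP; rewrite -tofrac_eq0; apply/eqP; rewrite -[RHS]p0.
rewrite (rmorph_mmap (@tofrac {mpoly R[i][N]})).
apply: eq_mmap => // c /=.
(* There is only one ring morphism from [rat] to a given field, so [ratr] into the fraction field
   factors through the constants. *)
exact: (fmorph_eq_rat (@tofrac {mpoly R[i][N]} \o @mpolyC N R[i] \o (ratr : rat -> R[i]))).
Qed.

(** * Orthogonal complements *)

Section Orthogonal.
Variable K : fieldType.

(* The column spaces of U and X are orthogonal complements in K^m. *)
Definition complementary m s a (U : 'M[K]_(m, s)) (X : 'M[K]_(m, a)) : Prop :=
  [/\ (s + a)%N = m, row_full U, row_full X & U^T *m X = 0].

Lemma complementaryC m s a (U : 'M[K]_(m, s)) (X : 'M[K]_(m, a)) :
  complementary U X -> complementary X U.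
Proof.
move=> [sa fU fX UX]; split=> //; first by rewrite addnC.
by apply: trmx_inj; rewrite trmx_mul trmxK UX trmx0.
Qed.

Lemma complementary_exists m s a (X : 'M[K]_(m, a)) :
  (s + a)%N = m -> row_full X -> exists U : 'M_(m, s), complementary U X.
Proof.
move=> sa fX; have rk : \rank (kermx X) = s by rewrite mxrank_ker (eqP fX) -sa addnK.
pose B := row_base (kermx X); have fB : row_free B by apply: row_base_free.
have BX : B *m X = 0.
  by apply/sub_kermxP; rewrite eq_row_base.
move: B fB BX; rewrite rk => B fB BX; exists B^T; split=> //.
  by rewrite /row_full mxrank_tr.
by rewrite trmxK.
Qed.

(** The column space of [X] lies in the kernel of [U^T] and has the same dimension. *)
Lemma complementary_ker m s a k (U : 'M[K]_(m, s)) (X : 'M[K]_(m, a)) (C : 'M_(m, k)) :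
  complementary U X -> U^T *m C = 0 -> exists P, C = X *m P.
Proof.
move=> [sa fU fX UX] UC.
have kerU n (B : 'M_(m, n)) : U^T *m B = 0 -> (B^T <= kermx U)%MS.
  by move=> UB; apply/sub_kermxP; apply: trmx_inj; rewrite trmx_mul trmxK UB trmx0.
have : (kermx U <= X^T)%MS.
  rewrite -(mxrank_leqif_sup (kerU _ _ UX)) mxrank_ker mxrank_tr (eqP fU) (eqP fX).
  by rewrite -sa addKn.
move=> /(submx_trans (kerU _ _ UC))/submxP[D hD]; exists D^T.
by apply: trmx_inj; rewrite trmx_mul trmxK.
Qed.

Section Bilinear.
Variables (m n s r a b : nat).
Variables (U : 'M[K]_(m, s)) (X : 'M[K]_(m, a)) (V : 'M[K]_(n, r)) (Y : 'M[K]_(n, b)).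
Hypotheses (UX : complementary U X) (VY : complementary V Y).

(** The kernel of a tensor product of two surjections is the sum of the two subspaces obtained from
    the kernel of one factor and the whole of the other. *)
Lemma mulmx_tensor0 (C : 'M_(m, n)) :
  U^T *m C *m V = 0 <-> exists P Q, C = X *m P + Q *m Y^T.
Proof.
split=> [UCV | [P [Q ->]]]; last first.
  have [_ _ _ UX0] := UX; have [_ _ _ YV0] := complementaryC VY.
  by rewrite mulmxDr mulmxA UX0 mul0mx add0r -!mulmxA YV0 !mulmx0.
have [G hG] : exists G, (U^T *m C)^T = Y *m G.
  apply: (complementary_ker VY); apply: trmx_inj.
  by rewrite trmx_mul !trmxK UCV trmx0.
(* [L^T] is a right inverse of [U^T], so [L^T *m (Y *m G)^T] has the same image under [U^T] as [C].
   It already has the form [Q *m Y^T], and the difference is killed by [U^T]. *)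
have [_ /row_fullP[L LU] _ _] := UX.
have [P hP] : exists P, C - L^T *m (Y *m G)^T = X *m P.
  apply: (complementary_ker UX).
  rewrite mulmxBr -hG trmxK [X in _ - X]mulmxA -[U^T *m L^T]trmx_mul LU trmx1.
  by rewrite mul1mx subrr.
exists P, (L^T *m G^T); rewrite -hP -mulmxA -[G^T *m _]trmx_mul.
by rewrite subrK.
Qed.

End Bilinear.

Section Quadratic.
Variables (n r d : nat) (V : 'M[K]_(n, r)) (X : 'M[K]_(n, d)).
Hypotheses (VX : complementary V X) (nz2 : 2%:R != 0 :> K).

Lemma mulmx_sym0 (C : 'M_n) : C^T = C ->
  V^T *m C *m V = 0 <-> exists A, C = A *m X^T + X *m A^T.
Proof.
move=> sC; rewrite (mulmx_tensor0 VX VX); split=> [[P [Q CPQ]] | [A ->]]; last first.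
  by exists A^T, A; rewrite addrC.
(* Add [C = X *m P + Q *m X^T] to its transpose and halve. *)
exists (2%:R^-1 *: (Q + P^T)); apply: (scalerI nz2).
rewrite scalerDr linearZ /= -scalemxAl -scalemxAr !scalerA mulfV // !scale1r.
rewrite [_ *: C]scaler_nat mulr2n -{2}sC CPQ !linearD /= !trmx_mul trmxK.
rewrite mulmxDl trmxK [X in X + _ = _]addrC -addrA [X in _ + X = _]addrCA.
by rewrite [X *m P + _]addrC addrA.
Qed.

Lemma mulmx_alt0 (C : 'M_n) : C^T = - C ->
  V^T *m C *m V = 0 <-> exists A, C = X *m A^T - A *m X^T.
Proof.
move=> sC; rewrite (mulmx_tensor0 VX VX); split=> [[P [Q CPQ]] | [A ->]]; last first.
  by exists A^T, (- A); rewrite mulNmx.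
(* Here the transpose is subtracted, since [C^T = - C]. *)
exists (2%:R^-1 *: (P^T - Q)); apply: (scalerI nz2).
rewrite scalerBr linearZ /= -scalemxAl -scalemxAr !scalerA mulfV // !scale1r.
rewrite [_ *: C]scaler_nat mulr2n -{2}[C]opprK -sC CPQ !linearD /= !trmx_mul trmxK.
rewrite trmxK linearN /= mulmxN mulmxBl opprB -!addrA; congr (_ + _).
by rewrite [RHS]addrC -addrA.
Qed.

End Quadratic.
End Orthogonal.

Lemma generic_row_full (K : fieldType) (S : finType) (x : S -> K) m s
    (g : 'I_m * 'I_s -> S) :
    generic_over_rat x -> injective g -> (s <= m)%N ->
  row_full (\matrix_(i, k) x (g (i, k))).
Proof.
move=> gx injg lesm; rewrite /row_full -mxrank_tr.
pose Q := \matrix_(k < s, i < m) gvar (g (i, k)).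
(* The special point at which the transposed matrix becomes [pid_mx s]; elements of [S] outside the
   image of [g] get the value 0. *)
pose z t : rat := [exists k, t == g (widen_ord lesm k, k)]%:R.
rewrite (_ : _^T = map_mx (mmap intr (x \o enum_val)) Q); last first.
  by apply/matrixP => k i; rewrite !mxE mmap_gvar.
apply: (row_free_generic (z := z \o enum_val) (generic_int gx)).
rewrite (_ : map_mx _ _ = pid_mx s) ?/row_free ?rank_pid_mx //.
apply/matrixP => k i; rewrite !mxE mmap_gvar /z ltn_ord andbT; congr (nat_of_bool _)%:R.
apply/existsP/eqP => [[l /eqP/injg[-> ->]] //|ki]; exists k.
by apply/eqP; congr (g (_, _)); apply: val_inj.
Qed.

(** * Ranks of the power matroids *)

Section Span.
Variable K : fieldType.

Lemma matrix_column_matroid (E : finType) a b (w : E -> 'M[K]_(a, b)) :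
  linear_matroid w = column_matroid (fun t e => w e t.1 t.2).
Proof.
have sumE (A : {set E}) (c : E -> K) i j :
    (\sum_(e in A) c e *: w e) i j = \sum_(e in A) c e * w e i j.
  by rewrite summxE; apply: eq_bigr => e _; rewrite mxE.
apply/funext => A; apply/propext; split=> ind c c0; apply: ind.
  apply/matrixP => i j; rewrite sumE mxE; move/ffunP/(_ (i, j)): c0.
  by rewrite sum_columns ffunE.
apply/ffunP => t; rewrite (sum_columns (fun t e => w e t.1 t.2)) -sumE c0.
by rewrite mxE ffunE.
Qed.

Lemma mulmx_delta m n s r (U : 'M[K]_(m, s)) (V : 'M[K]_(n, r)) i j :
  U^T *m delta_mx i j *m V = (row i U)^T *m row j V.
Proof.
by rewrite -(mul_delta_mx (0 : 'I_1)) mulmxA -[LHS]mulmxA -rowE tr_row colE.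
Qed.

Lemma mulmx_tensor_sum m n s r (U : 'M[K]_(m, s)) (G : 'M_(m, n)) (V : 'M[K]_(n, r)) :
  U^T *m G *m V = \sum_i \sum_j G i j *: ((row i U)^T *m row j V).
Proof.
rewrite {1}[G]matrix_sum_delta mulmx_sumr mulmx_suml; apply: eq_bigr => i _.
rewrite mulmx_sumr mulmx_suml; apply: eq_bigr => j _.
by rewrite -scalemxAr -scalemxAl mulmx_delta.
Qed.

Lemma mulmx_tensorE m n s r (U : 'M[K]_(m, s)) (G : 'M_(m, n)) (V : 'M[K]_(n, r)) k l :
  (U^T *m G *m V) k l = \sum_i \sum_j G i j * (U i k * V j l).
Proof.
rewrite mulmx_tensor_sum summxE; apply: eq_bigr => i _; rewrite summxE.
by apply: eq_bigr => j _; rewrite !mxE big_ord1 !mxE.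
Qed.

(** One rank computation for three cases: [phi] is the identity for tensors, [M - M^T] for wedges
    and [M + M^T] for symmetric products. Since [U] and [V] have full column rank, tensors of their
    rows span all matrices, so the images of matrix units have the same span as [w]. *)
Lemma card_basis_tensor (m n s r : nat) (E F : finType) (Z : lmodType K)
    (phi : {linear 'M[K]_(s, r) -> Z}) (ends : E -> 'I_m * 'I_n)
    (ends' : F -> 'I_s * 'I_r) (U : 'M[K]_(m, s)) (V : 'M[K]_(n, r)) :
    let w e := phi ((row (ends e).1 U)^T *m row (ends e).2 V) in
    let w' f := phi (delta_mx (ends' f).1 (ends' f).2) in
    row_full U -> row_full V ->
    (forall i j, inspan [set: E] w (phi ((row i U)^T *m row j V))) ->
    (forall k l, inspan [set: F] w' (phi (delta_mx k l))) ->
    linear_matroid w' [set: F] ->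
  forall B, basis (linear_matroid w) B -> #|B| = #|F|.
Proof.
have phiZ c M : phi (c *: M) = c *: phi M by exact: linearZ_LR.
move=> w w' /row_fullP[L LU] /row_fullP[L' LV] spanE spanF indF B.
apply: card_basis_span indF _ _ => [f|e].
  rewrite /w'; set D := delta_mx _ _.
  (* With left inverses [L] of [U] and [L'] of [V], the matrix unit [D] becomes a combination of
     tensors of rows. *)
  rewrite (_ : D = U^T *m (L^T *m D *m L') *m V); last first.
    by rewrite -!mulmxA LV mulmx1 mulmxA -trmx_mul LU trmx1 mul1mx.
  rewrite mulmx_tensor_sum linear_sum; apply: inspan_sum => i _.
  by rewrite linear_sum; apply: inspan_sum => j _; rewrite phiZ; apply: inspanZ.
rewrite /w; set D := _ *m _.
rewrite [D]matrix_sum_delta linear_sum; apply: inspan_sum => i _.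
by rewrite linear_sum; apply: inspan_sum => j _; rewrite phiZ; apply: inspanZ.
Qed.

End Span.

(** * Tensor, wedge and symmetric powers *)

Section Tensor.
Variables (m n : nat).

Definition tensor_columns (R : comNzRingType) s r (x : 'I_m * 'I_s + 'I_n * 'I_r -> R)
    (t : 'I_s * 'I_r) (e : 'I_m * 'I_n) : R :=
  x (inl (e.1, t.1)) * x (inr (e.2, t.2)).

Definition birigid_columns (R : comNzRingType) a b (x : 'I_m * 'I_a + 'I_n * 'I_b -> R)
    (row : 'I_a * 'I_n + 'I_b * 'I_m) (col : 'I_m * 'I_n) : R :=
  match row with
  | inl (j, k) => if col.2 == k then x (inl (col.1, j)) else 0
  | inr (l, i) => if col.1 == i then x (inr (col.2, l)) else 0
  end.

Definition leftmx (R : Type) s r (x : 'I_m * 'I_s + 'I_n * 'I_r -> R) : 'M_(m, s) :=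
  \matrix_(i, k) x (inl (i, k)).
Definition rightmx (R : Type) s r (x : 'I_m * 'I_s + 'I_n * 'I_r -> R) : 'M_(n, r) :=
  \matrix_(i, k) x (inr (i, k)).

Lemma tensor_dual (K : fieldType) s r a b (x : 'I_m * 'I_s + 'I_n * 'I_r -> K)
    (y : 'I_m * 'I_a + 'I_n * 'I_b -> K) :
    complementary (leftmx x) (leftmx y) -> complementary (rightmx x) (rightmx y) ->
  dual_matroids (column_matroid (tensor_columns x)) (column_matroid (birigid_columns y)).
Proof.
move=> Cl Cr; apply: column_matroid_dual => c.
pose C := \matrix_(i, j) c (i, j).
have relE : relation (tensor_columns x) c <-> (leftmx x)^T *m C *m rightmx x = 0.
  have e t : \sum_e c e * tensor_columns x t e =
      ((leftmx x)^T *m C *m rightmx x) t.1 t.2.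
    rewrite mulmx_tensorE pair_bigA /=; apply: eq_bigr => -[i j] _.
    by rewrite !mxE.
  split=> [rc|C0 t]; last by rewrite e C0 mxE.
  by apply/matrixP => k l; rewrite -(e (k, l)) rc mxE.
rewrite relE (mulmx_tensor0 Cl Cr).
have rowE P Q i k : (leftmx y *m P + Q *m (rightmx y)^T) i k =
    \sum_j P j k * y (inl (i, j)) + \sum_l Q i l * y (inr (k, l)).
  by rewrite !mxE; congr (_ + _); apply: eq_bigr => j _; rewrite !mxE 1?mulrC.
have sumE (z : 'I_a * 'I_n + 'I_b * 'I_m -> K) i k :
    \sum_s z s * birigid_columns y s (i, k) =
    \sum_j z (inl (j, k)) * y (inl (i, j)) + \sum_l z (inr (l, i)) * y (inr (k, l)).
  rewrite big_sumType /=; congr (_ + _).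
    rewrite (eq_bigr (fun p => z (inl (p.1, p.2)) *
      birigid_columns y (inl (p.1, p.2)) (i, k))) => [|[]//].
    rewrite -(pair_bigA _ (fun j k' => z (inl (j, k')) * birigid_columns y (inl (j, k')) (i, k))) /=.
    apply: eq_bigr => j _; rewrite (bigD1 k) //= eqxx big1 ?addr0 // => k'.
    by rewrite eq_sym => /negbTE->; rewrite mulr0.
  rewrite (eq_bigr (fun p => z (inr (p.1, p.2)) *
    birigid_columns y (inr (p.1, p.2)) (i, k))) => [|[]//].
  rewrite -(pair_bigA _ (fun l i' => z (inr (l, i')) * birigid_columns y (inr (l, i')) (i, k))) /=.
  apply: eq_bigr => l _; rewrite (bigD1 i) //= eqxx big1 ?addr0 // => i'.
  by rewrite eq_sym => /negbTE->; rewrite mulr0.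
split=> [[P [Q CPQ]]|[z hz]].
  exists (fun s => match s with inl p => P p.1 p.2 | inr p => Q p.2 p.1 end) => -[i k].
  by move/matrixP/(_ i k): CPQ; rewrite rowE sumE mxE.
exists (\matrix_(j, k) z (inl (j, k))), (\matrix_(i, l) z (inr (l, i))).
apply/matrixP => i k; rewrite rowE mxE hz sumE.
by congr (_ + _); apply: eq_bigr => j _; rewrite mxE.
Qed.

Lemma tensor_card_basis (K : fieldType) s r (x : 'I_m * 'I_s + 'I_n * 'I_r -> K) B :
    row_full (leftmx x) -> row_full (rightmx x) ->
  basis (column_matroid (tensor_columns x)) B -> #|B| = (s * r)%N.
Proof.
move=> fl fr.
have -> : column_matroid (tensor_columns x) =
    linear_matroid (fun e => idfun ((row e.1 (leftmx x))^T *m row e.2 (rightmx x))).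
  rewrite matrix_column_matroid; congr column_matroid.
  apply/funext => t; apply/funext => e.
  by rewrite /= !mxE big_ord1 !mxE.
move/(@card_basis_tensor K m n s r _ ('I_s * 'I_r)%type 'M[K]_(s, r) idfun id id) => -> //.
- by rewrite card_prod !card_ord.
- move=> i j; exact: (@inspan_mem _ _ _ _
    (fun e => idfun ((row e.1 (leftmx x))^T *m row e.2 (rightmx x))) (i, j)).
- by move=> k l; apply: (@inspan_mem _ _ _ _ (fun e : 'I_s * 'I_r => delta_mx e.1 e.2) (k, l)).
apply/linear_matroidT => c /matrixP c0 [i j]; have := c0 i j.
rewrite summxE mxE (bigD1 (i, j)) //= !mxE !eqxx mulr1 big1 ?addr0 // => -[k l].
by rewrite !mxE xpair_eqE negb_and => /orP[]; rewrite eq_sym => /negbTE->; rewrite ?andbF mulr0.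
Qed.

Lemma tensor_birigidity_dual (K L : fieldType) s r a b
    (x : 'I_m * 'I_s + 'I_n * 'I_r -> K) (y : 'I_m * 'I_a + 'I_n * 'I_b -> L) :
    (s + a)%N = m -> (r + b)%N = n -> generic_over_rat x -> generic_over_rat y ->
  dual_matroids (column_matroid (tensor_columns x)) (column_matroid (birigid_columns y)).
Proof.
move=> sa rb gx gy.
have flx : row_full (leftmx x).
  by apply: (generic_row_full (g := inl)) => //; first [by move=> ? ? [] | lia].
have frx : row_full (rightmx x).
  by apply: (generic_row_full (g := inr)) => //; first [by move=> ? ? [] | lia].
have fly : row_full (leftmx y).
  by apply: (generic_row_full (g := inl)) => //; first [by move=> ? ? [] | lia].
have fry : row_full (rightmx y).
  by apply: (generic_row_full (g := inr)) => //; first [by move=> ? ? [] | lia].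
pose mk (F : fieldType) c d (X : 'M[F]_(m, c)) (Y : 'M[F]_(n, d))
  (t : 'I_m * 'I_c + 'I_n * 'I_d) :=
  match t with inl p => X p.1 p.2 | inr p => Y p.1 p.2 end.
have lmk F c d X Y : leftmx (@mk F c d X Y) = X by apply/matrixP => ? ?; rewrite mxE.
have rmk F c d X Y : rightmx (@mk F c d X Y) = Y by apply/matrixP => ? ?; rewrite mxE.
(* [X], [Y] are special points over [K] complementary to the generic [x]; [U], [V] are special
   points over [L] complementary to the generic [y]. *)
have [X XC] : exists X : 'M_(m, a), complementary X (leftmx x).
  by apply: complementary_exists; rewrite // addnC.
have [Y YC] : exists Y : 'M_(n, b), complementary Y (rightmx x).
  by apply: complementary_exists; rewrite // addnC.
have [U UC] : exists U : 'M_(m, s), complementary U (leftmx y).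
  exact: complementary_exists.
have [V VC] : exists V : 'M_(n, r), complementary V (rightmx y).
  exact: complementary_exists.
apply: (@dual_matroids_transfer _ _ (column_matroid (tensor_columns (mk _ _ _ U V))) _
  (column_matroid (birigid_columns (mk _ _ _ X Y)))).
- by apply: tensor_dual; rewrite ?lmk ?rmk; apply: complementaryC.
- by apply: tensor_dual; rewrite ?lmk ?rmk.
- apply: (column_matroid_generic (z := mk _ _ _ U V) (P := tensor_columns (@gvar _)) gx) => t e.
    by rewrite rmorphM /= !mmap_gvar.
  by rewrite rmorphM /= !mmap_gvar.
- apply: (column_matroid_generic (z := mk _ _ _ X Y) (P := birigid_columns (@gvar _)) gy) => -[[j k]|[l i]] e /=;
    by case: (_ == _); rewrite ?raddf0 // mmap_gvar.
move=> A B /(tensor_card_basis flx frx)-> /tensor_card_basis -> //.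
  by rewrite lmk; case: UC.
by rewrite rmk; case: VC.
Qed.

End Tensor.

(** * Wedge powers and hyperconnectivity *)

Definition coordmx (R : Type) n r (x : 'I_n * 'I_r -> R) : 'M_(n, r) :=
  \matrix_(i, k) x (i, k).

Definition wedge_columns (R : comNzRingType) n r (x : 'I_n * 'I_r -> R)
    (t : 'I_r * 'I_r) (e : pairs n) : R :=
  x ((val e).1, t.1) * x ((val e).2, t.2) - x ((val e).2, t.1) * x ((val e).1, t.2).

Definition hyper_columns (R : comNzRingType) n d (x : 'I_n * 'I_d -> R)
    (row : 'I_n * 'I_d) (col : pairs n) : R :=
  if row.1 == (val col).2 then x ((val col).1, row.2)
  else if row.1 == (val col).1 then - x ((val col).2, row.2) else 0.


Section Wedge.
Variables (K : fieldType) (n : nat).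


(** Packs the coefficients of a relation into an alternating matrix, which turns the relation into a
    single matrix equation. *)
Definition alternating (c : pairs n -> K) : 'M[K]_n :=
  \sum_e c e *: (delta_mx (val e).1 (val e).2 - delta_mx (val e).2 (val e).1).

Lemma alternating_tr c : (alternating c)^T = - alternating c.
Proof.
rewrite linear_sum -sumrN; apply: eq_bigr => e _.
by rewrite linearZ /= linearB /= !trmx_delta -scalerN opprB.
Qed.

Lemma alternatingE c e : alternating c (val e).1 (val e).2 = c e.
Proof.
rewrite summxE (bigD1 e) //= big1 => [|f nef]; last first.
  rewrite !mxE; case: f nef => -[i j] /= ltij; rewrite -val_eqE /=.
  case: e => -[k l] /= ltkl; rewrite xpair_eqE => /negbTE.
  rewrite [i == k]eq_sym [j == l]eq_sym => ->.
  by case: (k =P j) => [kj|]; case: (l =P i) => [li|]; subst; rewrite ?subr0 ?mulr0 //; lia.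
rewrite !mxE !eqxx /= [_ == (val e).1]eq_sym (_ : (_ == _) = false) ?subr0 ?mulr1 ?addr0 //.
by case: e => -[k l] /= ltkl; apply/negbTE; rewrite neq_ltn ltkl.
Qed.

Lemma alternating_eq0 (M : 'M[K]_n) : 2%:R != 0 :> K -> M^T = - M ->
  (forall e : pairs n, M (val e).1 (val e).2 = 0) -> M = 0.
Proof.
move=> nz2 aM M0; have MC i j : M j i = - M i j.
  by have /matrixP/(_ i j) := aM; rewrite !mxE.
apply/matrixP => i j; rewrite mxE; case: (ltngtP i j) => [lt|gt|/val_inj ->].
- exact: (M0 (exist _ (i, j) lt)).
- by rewrite MC (M0 (exist _ (j, i) gt)) oppr0.
apply/eqP; have /eqP := MC j j; rewrite -addr_eq0 -mulr2n -mulr_natl mulf_eq0.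
by rewrite (negbTE nz2).
Qed.

Lemma relation_wedge r (x : 'I_n * 'I_r -> K) c :
  relation (wedge_columns x) c <-> (coordmx x)^T *m alternating c *m coordmx x = 0.
Proof.
have e t : \sum_e c e * wedge_columns x t e =
    ((coordmx x)^T *m alternating c *m coordmx x) t.1 t.2.
  rewrite mulmx_sumr mulmx_suml summxE; apply: eq_bigr => e _.
  rewrite -scalemxAr -scalemxAl mxE; congr (_ * _).
  rewrite mulmxBr mulmxBl !mulmx_delta.
  by rewrite !mxE !big_ord1 !mxE.
split=> [rc|C0 t]; last by rewrite e C0 mxE.
by apply/matrixP => k l; rewrite -(e (k, l)) rc mxE.
Qed.

Lemma hyper_rowE d (x : 'I_n * 'I_d -> K) (y : 'I_n * 'I_d -> K) e :
  \sum_s y s * hyper_columns x s e =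
  (coordmx x *m (coordmx y)^T - coordmx y *m (coordmx x)^T) (val e).1 (val e).2.
Proof.
case: e => -[k l] ltkl; rewrite !mxE -sumrB.
rewrite (eq_bigr (fun p => y (p.1, p.2) * hyper_columns x (p.1, p.2) (exist _ (k, l) ltkl))) => [|[]//].
rewrite -(pair_bigA _ (fun i j => y (i, j) * hyper_columns x (i, j) (exist _ (k, l) ltkl))) /=.
rewrite exchange_big; apply: eq_bigr => j _ /=; rewrite !mxE.
have nkl : k != l by rewrite neq_ltn ltkl.
rewrite (bigD1 l) //= (bigD1 k) //= big1 ?addr0 => [|i /andP[/negbTE nl /negbTE nk]].
  by rewrite /hyper_columns /= eqxx (negbTE nkl) eqxx mulrN [X in X - _]mulrC.
by rewrite /hyper_columns /= nl nk mulr0.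
Qed.

Lemma wedge_dual r d (x : 'I_n * 'I_r -> K) (y : 'I_n * 'I_d -> K) :
    2%:R != 0 :> K -> complementary (coordmx x) (coordmx y) ->
  dual_matroids (column_matroid (wedge_columns x)) (column_matroid (hyper_columns y)).
Proof.
move=> nz2 C; apply: column_matroid_dual => c.
rewrite relation_wedge (mulmx_alt0 C nz2 (alternating_tr c)).
split=> [[A cA]|[z hz]].
  exists (fun p => A p.1 p.2) => e; rewrite hyper_rowE -alternatingE cA.
  by rewrite (_ : coordmx (fun p => A p.1 p.2) = A) //; apply/matrixP => i j; rewrite mxE.
exists (coordmx z); apply/eqP; rewrite -subr_eq0; apply/eqP/alternating_eq0 => // [|e].
  rewrite [LHS]linearB [X in _ - X]linearB /= alternating_tr !trmx_mul !trmxK.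
  by rewrite [RHS]opprB addrC opprB.
by rewrite mxE alternatingE hz hyper_rowE [X in _ + X]mxE subrr.
Qed.

End Wedge.

Lemma wedge_card_basis (K : fieldType) n r (x : 'I_n * 'I_r -> K) B : row_full (coordmx x) ->
  basis (column_matroid (wedge_columns x)) B -> #|B| = #|{: pairs r}|.
Proof.
move=> fx; pose phi : {linear 'M[K]_r -> 'M[K]_r} := idfun \- @trmx K r r.
pose w (e : pairs n) := phi ((row (val e).1 (coordmx x))^T *m row (val e).2 (coordmx x)).
have -> : column_matroid (wedge_columns x) = linear_matroid w.
  rewrite matrix_column_matroid; congr column_matroid.
  apply/funext => t; apply/funext => e.
  by rewrite /w /= !mxE !big_ord1 !mxE [X in _ - X]mulrC.
pose w' (f : pairs r) := phi (delta_mx (val f).1 (val f).2).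
apply: (@card_basis_tensor K n n r r _ (pairs r) _ phi val val) => //.
- move=> i j; case: (ltngtP i j) => [lt|gt|/val_inj ->].
  + exact: (@inspan_mem _ _ _ _ w (exist _ (i, j) lt)).
  + rewrite (_ : phi _ = -1 *: w (exist _ (j, i) gt)).
      exact/inspanZ/inspan_mem.
    by rewrite scaleN1r /w /= opprB !trmx_mul !trmxK.
  + by rewrite /= trmx_mul trmxK subrr; apply: inspan0.
- move=> i j; case: (ltngtP i j) => [lt|gt|/val_inj ->].
  + exact: (@inspan_mem _ _ _ _ w' (exist _ (i, j) lt)).
  + rewrite (_ : phi _ = -1 *: w' (exist _ (j, i) gt)).
      exact/inspanZ/inspan_mem.
    by rewrite scaleN1r /w' /= opprB !trmx_delta.
  + by rewrite /= trmx_delta subrr; apply: inspan0.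
apply/linear_matroidT => c c0 e.
suff a0 : alternating c = 0 by rewrite -(alternatingE c e) a0 mxE.
by rewrite -[RHS]c0; apply: eq_bigr => f _; rewrite /w' /= trmx_delta.
Qed.

Lemma wedge_hyperconnectivity_dual (K L : fieldType) n r d
    (x : 'I_n * 'I_r -> K) (y : 'I_n * 'I_d -> L) :
    2%:R != 0 :> K -> 2%:R != 0 :> L ->
    (r + d)%N = n -> generic_over_rat x -> generic_over_rat y ->
  dual_matroids (column_matroid (wedge_columns x)) (column_matroid (hyper_columns y)).
Proof.
move=> nz2K nz2L rd gx gy.
have fx : row_full (coordmx x) by apply: (generic_row_full (g := id)) => //; lia.
have fy : row_full (coordmx y) by apply: (generic_row_full (g := id)) => //; lia.
pose mk (F : fieldType) c (X : 'M[F]_(n, c)) (t : 'I_n * 'I_c) := X t.1 t.2.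
have mkE F c X : coordmx (@mk F c X) = X by apply/matrixP => ? ?; rewrite mxE.
have [X XC] : exists X : 'M_(n, d), complementary X (coordmx x).
  by apply: complementary_exists; rewrite // addnC.
have [V VC] : exists V : 'M_(n, r), complementary V (coordmx y).
  exact: complementary_exists.
apply: (@dual_matroids_transfer _ _ (column_matroid (wedge_columns (mk _ _ V))) _
  (column_matroid (hyper_columns (mk _ _ X)))).
- by apply: wedge_dual; rewrite ?mkE //; apply: complementaryC.
- by apply: wedge_dual; rewrite ?mkE.
- apply: (column_matroid_generic (z := mk _ _ V) (P := wedge_columns (@gvar _)) gx) => t e;
    by rewrite rmorphB !rmorphM /= !mmap_gvar.
- apply: (column_matroid_generic (z := mk _ _ X) (P := hyper_columns (@gvar _)) gy) => t e;
    by rewrite /hyper_columns; case: (t.1 == _); [|case: (t.1 == _)]; rewrite ?raddf0 ?raddfN /= ?mmap_gvar.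
move=> A B /(wedge_card_basis fx)-> /wedge_card_basis -> //.
by rewrite mkE; case: VC.
Qed.

(** * Symmetric powers and Gram matrices *)

Lemma column_matroid_scale (K : fieldType) (T E : finType) (M : T -> E -> K) (s : E -> K) :
  (forall e, s e != 0) -> column_matroid (fun t e => s e * M t e) = column_matroid M.
Proof.
move=> nzs; rewrite -[RHS](linear_matroid_scale _ nzs); congr linear_matroid.
by apply/funext => e; apply/ffunP => t; rewrite !ffunE.
Qed.

(** A diagonal element is treated as a loop with both ends equal, so that one formula covers both
    kinds of elements. *)
Definition ends n (e : pairs n + 'I_n) : 'I_n * 'I_n :=
  match e with inl e => val e | inr i => (i, i) end.

(** The symmetric matrix [u^T *m v + v^T *m u], which stands for twice the product of [u] and [v] in
    the symmetric square. *)
Definition sym_columns (R : comNzRingType) n r (x : 'I_n * 'I_r -> R)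
    (t : 'I_r * 'I_r) (e : pairs n + 'I_n) : R :=
  x ((ends e).1, t.1) * x ((ends e).2, t.2) + x ((ends e).2, t.1) * x ((ends e).1, t.2).

(* The Jacobian matrix of the entries of X X^T with respect to those of X. *)
Definition gram_columns (R : comNzRingType) n d (x : 'I_n * 'I_d -> R)
    (row : 'I_n * 'I_d) (e : pairs n + 'I_n) : R :=
  (row.1 == (ends e).1)%:R * x ((ends e).2, row.2) +
  (row.1 == (ends e).2)%:R * x ((ends e).1, row.2).

Lemma ends_le n (e : pairs n + 'I_n) : ((ends e).1 <= (ends e).2)%N.
Proof. by case: e => [[[i j] /= /ltnW]|i] /=. Qed.

Lemma ends_inj n : injective (@ends n).
Proof.
move=> [e|i] [f|j] //= => [/val_inj->|ej|ei|[->]] //.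
- by have := valP e; rewrite /= ej ltnn.
- by have := valP f; rewrite /= -ei ltnn.
Qed.

Lemma ends_onto n (i j : 'I_n) : (i <= j)%N -> exists e, ends e = (i, j).
Proof.
case: ltngtP => [lt _|//|/val_inj-> _]; last by exists (inr j).
by exists (inl (exist _ (i, j) lt)).
Qed.

Section Sym.
Variables (K : fieldType) (n : nat).
Hypothesis nz2 : 2%:R != 0 :> K.

Definition symmetric (c : pairs n + 'I_n -> K) : 'M[K]_n :=
  \sum_e c e *: (delta_mx (ends e).1 (ends e).2 + delta_mx (ends e).2 (ends e).1).

(** On the diagonal the two matrix units in [symmetric] coincide, and the entry is doubled. *)
Definition multiplicity (e : pairs n + 'I_n) : K := if e is inl _ then 1 else 2%:R.

Lemma multiplicity_neq0 e : multiplicity e != 0.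
Proof. by case: e => [e|i] /=; rewrite ?oner_eq0. Qed.

Lemma symmetric_tr c : (symmetric c)^T = symmetric c.
Proof.
rewrite linear_sum; apply: eq_bigr => e _.
by rewrite linearZ /= linearD /= !trmx_delta addrC.
Qed.

Lemma symmetricE c e : symmetric c (ends e).1 (ends e).2 = multiplicity e * c e.
Proof.
rewrite summxE (bigD1 e) //= big1 => [|f]; last first.
  rewrite -(inj_eq (@ends_inj n)) !mxE; move: (ends_le e) (ends_le f).
  case: (ends e) (ends f) => [k l] [i j] /= lekl leij; rewrite xpair_eqE => nef.
  rewrite [k == i]eq_sym [l == j]eq_sym (negbTE nef) add0r.
  case: eqP => [kj|_]; case: eqP => [li|_]; rewrite /= ?mulr0 //; subst.
  have ij : i = j by apply: val_inj; apply/eqP; rewrite eqn_leq leij.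
  by rewrite ij eqxx in nef.
rewrite !mxE addr0 mulrC; congr (_ * _).
case: e => [[[i j] /= ltij]|i] /=; rewrite !eqxx //=.
by rewrite -!val_eqE /= (ltn_eqF ltij) addr0.
Qed.

Lemma sym_eq0 (M : 'M[K]_n) : M^T = M ->
  (forall e, M (ends e).1 (ends e).2 = 0) -> M = 0.
Proof.
move=> sM M0; have MC i j : M j i = M i j by rewrite -{1}sM mxE.
have le0 (i j : 'I_n) : (i <= j)%N -> M i j = 0.
  by move=> /ends_onto[e ee]; have := M0 e; rewrite ee.
apply/matrixP => i j; rewrite mxE; case/orP: (leq_total i j) => /le0 //.
by rewrite MC.
Qed.

Lemma relation_sym r (x : 'I_n * 'I_r -> K) c :
  relation (sym_columns x) c <-> (coordmx x)^T *m symmetric c *m coordmx x = 0.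
Proof.
have e t : \sum_e c e * sym_columns x t e =
    ((coordmx x)^T *m symmetric c *m coordmx x) t.1 t.2.
  rewrite mulmx_sumr mulmx_suml summxE; apply: eq_bigr => e _.
  rewrite -scalemxAr -scalemxAl mxE; congr (_ * _).
  rewrite mulmxDr mulmxDl !mulmx_delta.
  by rewrite !mxE !big_ord1 !mxE.
split=> [rc|C0 t]; last by rewrite e C0 mxE.
by apply/matrixP => k l; rewrite -(e (k, l)) rc mxE.
Qed.

Lemma gram_rowE d (x : 'I_n * 'I_d -> K) (y : 'I_n * 'I_d -> K) e :
  \sum_s y s * gram_columns x s e =
  (coordmx y *m (coordmx x)^T + coordmx x *m (coordmx y)^T) (ends e).1 (ends e).2.
Proof.
rewrite /gram_columns; case: (ends e) => k l /=; rewrite !mxE -big_split /=.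
rewrite (eq_bigr (fun p => y (p.1, p.2) *
  ((p.1 == k)%:R * x (l, p.2) + (p.1 == l)%:R * x (k, p.2)))) => [|[]//].
rewrite -(pair_bigA _ (fun i j => y (i, j) *
  ((i == k)%:R * x (l, j) + (i == l)%:R * x (k, j)))) /=.
rewrite exchange_big; apply: eq_bigr => j _ /=; rewrite !mxE.
have h m z : \sum_i y (i, j) * ((i == m)%:R * z) = y (m, j) * z.
  rewrite (bigD1 m) //= eqxx mul1r big1 ?addr0 // => i /negbTE->.
  by rewrite mul0r mulr0.
under eq_bigr do rewrite mulrDr.
by rewrite big_split /= !h [X in _ + X]mulrC.
Qed.

Lemma sym_dual r d (x : 'I_n * 'I_r -> K) (y : 'I_n * 'I_d -> K) :
    complementary (coordmx x) (coordmx y) ->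
  dual_matroids (column_matroid (sym_columns x)) (column_matroid (gram_columns y)).
Proof.
(* Rescaling the Gram columns undoes the doubled diagonal of [symmetric c] and leaves the matroid
   unchanged. *)
move=> C; pose s e := (multiplicity e)^-1.
have nzs e : s e != 0 by rewrite invr_eq0 multiplicity_neq0.
rewrite -(column_matroid_scale (gram_columns y) nzs); apply: column_matroid_dual => c.
have sumE (z : 'I_n * 'I_d -> K) e :
    \sum_t z t * (s e * gram_columns y t e) = s e * (\sum_t z t * gram_columns y t e).
  by rewrite mulr_sumr; apply: eq_bigr => t _; rewrite mulrCA.
rewrite relation_sym (mulmx_sym0 C nz2 (symmetric_tr c)).
split=> [[A cA]|[z hz]].
  exists (fun p => A p.1 p.2) => e; rewrite sumE gram_rowE.
  rewrite (_ : coordmx (fun p => A p.1 p.2) = A); last first.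
    by apply/matrixP => i j; rewrite mxE.
  by rewrite -cA symmetricE mulKf // multiplicity_neq0.
exists (coordmx z); apply/eqP; rewrite -subr_eq0; apply/eqP/sym_eq0 => [|e].
  rewrite [LHS]linearB [X in _ - X]linearD /= symmetric_tr !trmx_mul !trmxK.
  by rewrite [X in _ - X]addrC.
rewrite mxE symmetricE hz sumE gram_rowE [X in _ + X]mxE.
by rewrite mulVKf ?multiplicity_neq0 // subrr.
Qed.

End Sym.

Lemma sym_card_basis (K : fieldType) n r (x : 'I_n * 'I_r -> K) B :
    2%:R != 0 :> K -> row_full (coordmx x) ->
  basis (column_matroid (sym_columns x)) B -> #|B| = #|{: pairs r + 'I_r}|.
Proof.
move=> nz2 fx; pose phi : {linear 'M[K]_r -> 'M[K]_r} := idfun \+ @trmx K r r.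
have phiC i j (X : 'M[K]_(n, r)) :
    phi ((row i X)^T *m row j X) = phi ((row j X)^T *m row i X).
  by rewrite /= !trmx_mul !trmxK addrC.
have phidC k l : phi (delta_mx k l) = phi (delta_mx l k).
  by rewrite /= !trmx_delta addrC.
pose w e := phi ((row (ends e).1 (coordmx x))^T *m row (ends e).2 (coordmx x)).
have -> : column_matroid (sym_columns x) = linear_matroid w.
  rewrite matrix_column_matroid; congr column_matroid.
  apply/funext => t; apply/funext => e.
  by rewrite /w /= !mxE !big_ord1 !mxE [X in _ + X]mulrC.
pose w' (f : pairs r + 'I_r) := phi (delta_mx (ends f).1 (ends f).2).
apply: (@card_basis_tensor K n n r r _ _ _ phi (@ends n) (@ends r)) => //.
- move=> i j; wlog le_ij : i j / (i <= j)%N => [h|].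
    by case/orP: (leq_total i j) => [/h//|/h]; rewrite phiC.
  have [e ee] := ends_onto le_ij.
  by have := @inspan_mem _ _ _ [set: _] w e (in_setT _); rewrite {2}/w ee.
- move=> i j; wlog le_ij : i j / (i <= j)%N => [h|].
    by case/orP: (leq_total i j) => [/h//|/h]; rewrite phidC.
  have [e ee] := ends_onto le_ij.
  by have := @inspan_mem _ _ _ [set: _] w' e (in_setT _); rewrite {2}/w' ee.
apply/linear_matroidT => c c0 e; apply: (mulfI (multiplicity_neq0 nz2 e)).
rewrite -symmetricE mulr0 (_ : symmetric c = 0) ?mxE //.
by rewrite -[RHS]c0; apply: eq_bigr => f _; rewrite /= trmx_delta.
Qed.

Lemma sym_gram_dual (K L : fieldType) n r d
    (x : 'I_n * 'I_r -> K) (y : 'I_n * 'I_d -> L) :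
    2%:R != 0 :> K -> 2%:R != 0 :> L ->
    (r + d)%N = n -> generic_over_rat x -> generic_over_rat y ->
  dual_matroids (column_matroid (sym_columns x)) (column_matroid (gram_columns y)).
Proof.
move=> nz2K nz2L rd gx gy.
have fx : row_full (coordmx x) by apply: (generic_row_full (g := id)) => //; lia.
have fy : row_full (coordmx y) by apply: (generic_row_full (g := id)) => //; lia.
pose mk (F : fieldType) c (X : 'M[F]_(n, c)) (t : 'I_n * 'I_c) := X t.1 t.2.
have mkE F c X : coordmx (@mk F c X) = X by apply/matrixP => ? ?; rewrite mxE.
have [X XC] : exists X : 'M_(n, d), complementary X (coordmx x).
  by apply: complementary_exists; rewrite // addnC.
have [V VC] : exists V : 'M_(n, r), complementary V (coordmx y).
  exact: complementary_exists.
apply: (@dual_matroids_transfer _ _ (column_matroid (sym_columns (mk _ _ V))) _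
  (column_matroid (gram_columns (mk _ _ X)))).
- by apply: sym_dual; rewrite ?mkE //; apply: complementaryC.
- by apply: sym_dual; rewrite ?mkE.
- apply: (column_matroid_generic (z := mk _ _ V) (P := sym_columns (@gvar _)) gx) => t e;
    by rewrite rmorphD !rmorphM /= !mmap_gvar.
- apply: (column_matroid_generic (z := mk _ _ X) (P := gram_columns (@gvar _)) gy) => t e;
    by rewrite rmorphD !rmorphM /= !mmap_gvar !rmorph_nat.
move=> A B /(sym_card_basis nz2K fx)-> /(sym_card_basis nz2L)-> //.
by rewrite mkE; case: VC.
Qed.

(** * The Jacobian criterion *)

Lemma mderivXU (A : nzRingType) k (i j : 'I_k) : ('X_i : {mpoly A[k]})^`M(j) = (i == j)%:R.
Proof.
rewrite mderivX mnm1E; case: eqP => [->|_]; last by rewrite scale0r.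
rewrite scale1r -mpolyX0; congr mpolyX; apply/mnmP => l.
by rewrite mnmBE subnn mnm0E.
Qed.

Section Substitution.
Variable F : numFieldType.

Definition msubst k N (G : 'I_k -> {mpoly F[N]}) (p : {mpoly F[k]}) : {mpoly F[N]} :=
  mmap (@mpolyC N F) G p.

HB.instance Definition _ k N (G : 'I_k -> {mpoly F[N]}) :=
  GRing.RMorphism.copy (msubst G) (mmap (@mpolyC N F) G).

Lemma msubstC k N (G : 'I_k -> {mpoly F[N]}) c : msubst G c%:MP = c%:MP.
Proof. exact: mmapC. Qed.

Lemma msubstX k N (G : 'I_k -> {mpoly F[N]}) i : msubst G 'X_i = G i.
Proof. exact: mmapXU. Qed.

Lemma msubst_comp k l N (G : 'I_l -> {mpoly F[N]}) (H : 'I_k -> {mpoly F[l]}) p :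
  msubst G (msubst H p) = msubst (msubst G \o H) p.
Proof.
rewrite {2}/msubst (rmorph_mmap (msubst G)); apply: eq_mmap => // c /=.
exact: msubstC.
Qed.

Lemma eq_msubst k N (G H : 'I_k -> {mpoly F[N]}) p : G =1 H -> msubst G p = msubst H p.
Proof. by move=> GH; apply: eq_mmap. Qed.

Lemma msubst_id k (p : {mpoly F[k]}) : msubst (fun i => 'X_i) p = p.
Proof.
rewrite [RHS]mpolyE /msubst /mmap; apply: eq_bigr => m _.
by rewrite mmap1_id mul_mpolyC.
Qed.

Lemma msubst_meval k N (G : 'I_k -> {mpoly F[N]}) p v :
  (msubst G p).@[v] = p.@[fun i => (G i).@[v]].
Proof.
rewrite /meval (rmorph_mmap (meval v)) /=; apply: eq_mmap => // c /=.
exact: mevalC.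
Qed.

(** The polynomials obeying this chain rule contain constants and variables and are closed under
    sums and products. [D] is abstract so as to cover both partial derivatives and the derivative of
    univariate polynomials. *)
Lemma derivation_mmap (B : comNzRingType) k (f : {rmorphism F -> B}) (h : 'I_k -> B)
    (D : B -> B) p :
    {morph D : x y / x + y} -> (forall x y, D (x * y) = D x * y + x * D y) ->
    (forall c, D (f c) = 0) ->
  D (mmap f h p) = \sum_i mmap f h p^`M(i) * D (h i).
Proof.
move=> DD DM DC.
pose good q := D (mmap f h q) = \sum_i mmap f h q^`M(i) * D (h i).
have goodC c : good c%:MP.
  by rewrite /good mmapC DC big1 // => i _; rewrite mderivC raddf0 mul0r.
have goodD q r : good q -> good r -> good (q + r).
  rewrite /good => gq gr; rewrite rmorphD /= DD gq gr -big_split.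
  by apply: eq_bigr => i _; rewrite mderivD rmorphD mulrDl.
have goodM q r : good q -> good r -> good (q * r).
  rewrite /good => gq gr; rewrite rmorphM /= DM gq gr.
  rewrite mulr_suml mulr_sumr -big_split; apply: eq_bigr => i _ /=.
  rewrite mderivM rmorphD !rmorphM /= mulrDl.
  by congr (_ + _); [exact: mulrAC | exact: mulrA].
have goodX i : good 'X_i.
  rewrite /good mmapXU (bigD1 i) //= mderivXU eqxx rmorph1 mul1r big1 ?addr0 // => l nl.
  by rewrite mderivXU eq_sym (negbTE nl) raddf0 mul0r.
have good1 : good 1 by apply: (goodC 1).
have goodXm m : good 'X_[m].
  rewrite mpolyXE_id; apply: (big_ind good) => // i _.
  by elim: (m i) => [//|e IH]; rewrite exprS; apply: goodM.
rewrite -/(good p) [p]mpolyE; apply: (big_ind good) => // [|m _].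
  exact: (goodC 0).
by rewrite -mul_mpolyC; apply: goodM.
Qed.

Lemma mderiv_msubst k N (G : 'I_k -> {mpoly F[N]}) p j :
  (msubst G p)^`M(j) = \sum_i msubst G p^`M(i) * (G i)^`M(j).
Proof.
exact: (@derivation_mmap _ _ (@mpolyC N F) G _ p (mderivD j) (mderivM j) (mderivC j)).
Qed.

Lemma mderiv_eq0 k (p : {mpoly F[k]}) i (m : 'X_{1..k}) : p^`M(i) = 0 -> m i != 0%N -> p@_m = 0.
Proof.
move=> dp mi; have := mcoeff_deriv i (m - U_(i))%MM p.
rewrite submK ?lep1mP // dp mcoeff0 => /esym/eqP.
by rewrite -mulr_natl mulf_eq0 pnatr_eq0 /= => /eqP.
Qed.

Lemma mderiv_eq0_const k (p : {mpoly F[k]}) : (forall i, p^`M(i) = 0) -> p = (p@_0)%:MP.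
Proof.
move=> dp; apply/mpolyP => m; rewrite mcoeffC.
have [->|nm] := eqVneq m 0%MM; first by rewrite mulr1.
rewrite mulr0.
have [i mi] : exists i, m i != 0%N.
  apply/existsP; rewrite -negb_forall; apply: contraNN nm => /forallP m0.
  by apply/eqP/mnmP => i; rewrite mnm0E; apply/eqP.
exact: mderiv_eq0 (dp i) mi.
Qed.

Lemma msize_mderiv k (p : {mpoly F[k]}) i : p != 0 -> (msize p^`M(i) < msize p)%N.
Proof.
move=> nzp; rewrite [X in (_ < X)%N](mpolySpred _ nzp) ltnS msizeE.
apply/bigmax_leqP_seq => m; rewrite mcoeff_msupp mcoeff_deriv => h _.
have : (m + U_(i))%MM \in msupp p.
  by rewrite mcoeff_msupp; apply: contraNN h => /eqP->; rewrite mul0rn.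
by move/msize_mdeg_lt; rewrite mdegD mdeg1; lia.
Qed.

(** By induction on the size: the partial derivatives vanish everywhere too, so they are 0 and the
    polynomial is constant. *)
Lemma meval_eq0 k (p : {mpoly F[k]}) : (forall v, p.@[v] = 0) -> p = 0.
Proof.
have [s] := ubnP (msize p); elim: s p => // s IHs p ltps pv.
apply: contrapT => /eqP nzp.
have dp i : p^`M(i) = 0.
  apply: IHs => [|v]; first by have := msize_mderiv i nzp; lia.
  (* The line through [v] parallel to the [i]-th axis; the restriction of [p] to it is the zero
     polynomial, hence so is its derivative. *)
  pose h l : {poly F} := (v l)%:P + (l == i)%:R *: 'X.
  have q0 : mmap polyC h p = 0 by apply: poly_fun0 => t; rewrite horner_mmap.
  have := @derivation_mmap _ _ (@polyC F) h _ p (@derivD F) (@derivM F) (@derivC F).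
  rewrite q0 deriv0 (bigD1 i) //= big1 => [|l /negbTE nl]; last first.
    by rewrite derivD derivC derivZ nl scale0r addr0 mulr0.
  rewrite derivD derivC derivZ derivX eqxx scale1r add0r addr0 mulr1 => /esym d0.
  rewrite -[RHS](horner0 0) -d0 horner_mmap; apply: meval_eq => l.
  by rewrite !hornerE.
have pE := mderiv_eq0_const dp; have := pv (fun=> 0).
by rewrite pE mevalC => p00; case/eqP: nzp; rewrite pE p00 mpolyC0.
Qed.

Lemma msubst_support k (B : {set 'I_k}) (p : {mpoly F[k]}) :
    (forall i, i \notin B -> p^`M(i) = 0) ->
  msubst (fun i => if i \in B then 'X_i else 0) p = p.
Proof.
move=> pB; rewrite -[RHS]msubst_id; rewrite /msubst /mmap.
apply: eq_big_seq => m mp; congr (_ * _); apply: eq_bigr => i _.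
case: ifPn => // niB; suff -> : m i = 0%N by rewrite !expr0.
apply/eqP; apply: contraTT mp => /(mderiv_eq0 (pB i niB)) h.
by rewrite mcoeff_msupp h eqxx.
Qed.

(* Polynomials in the variables of A are those with no partial derivative
   outside A; this avoids reindexing when A varies. *)
Definition algindep k N (G : 'I_k -> {mpoly F[N]}) (A : {set 'I_k}) : Prop :=
  forall p : {mpoly F[k]}, (forall i, i \notin A -> p^`M(i) = 0) ->
    msubst G p = 0 -> p = 0.

(** Renaming by [h] is inverted by [inv], which kills the variables outside the image; a polynomial
    with no derivative there loses nothing. *)
Lemma algindep_imset k l N (G : 'I_l -> {mpoly F[N]}) (h : 'I_k -> 'I_l) :
    injective h ->
  (forall p : {mpoly F[k]}, msubst (G \o h) p = 0 -> p = 0) <->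
  algindep G (h @: setT).
Proof.
move=> injh; pose inv (i : 'I_l) : {mpoly F[k]} :=
  if [pick j | h j == i] is Some j then 'X_j else 0.
have invh j : inv (h j) = 'X_j.
  rewrite /inv; case: pickP => [j' /eqP/injh->//|/(_ j)]; by rewrite eqxx.
have ninvh i : i \notin h @: setT -> inv i = 0.
  move=> nh; rewrite /inv; case: pickP => // j /eqP hj.
  by rewrite -hj imset_f ?inE in nh.
split=> [ind p pB p0 | ind p p0].
  pose q := msubst inv p.
  have pq : msubst (fun j => 'X_(h j)) q = p.
    rewrite msubst_comp -[RHS](msubst_support pB); apply: eq_msubst => i /=.
    case: ifPn => [/imsetP[j _ ->]|/ninvh->]; last exact: raddf0.
    by rewrite invh msubstX.
  rewrite -pq (ind q) ?raddf0 //.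
  rewrite -[RHS]p0 -pq msubst_comp; apply: eq_msubst => i /=.
  by rewrite msubstX.
pose q : {mpoly F[l]} := msubst (fun j => 'X_(h j)) p.
have qp : msubst inv q = p.
  rewrite msubst_comp -[RHS]msubst_id; apply: eq_msubst => i /=.
  by rewrite msubstX invh.
rewrite -qp (ind q) ?raddf0 // => [i niB|].
  rewrite /q mderiv_msubst big1 // => j _; rewrite mderivXU.
  have /negbTE-> : h j != i by apply: contraNneq niB => <-; rewrite imset_f.
  by rewrite mulr0.
rewrite /q msubst_comp -[RHS]p0; apply: eq_msubst => i /=.
exact: msubstX.
Qed.

End Substitution.

Lemma linear_matroid_imset (K : fieldType) (V : lmodType K) (I J : finType)
    (f : I -> J) (v : J -> V) (A : {set I}) : injective f ->
  linear_matroid (v \o f) A <-> linear_matroid v (f @: A).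
Proof.
move=> injf; split=> ind c.
  rewrite big_imset /=; last by move=> ? ? _ _ /injf.
  by move=> /ind h _ /imsetP[i iA ->]; apply: h.
move=> c0 i iA; pose c' j := \sum_(i in A) (f i == j)%:R * c i.
have cE l : l \in A -> c' (f l) = c l.
  move=> lA; rewrite /c' (bigD1 l) //= eqxx mul1r big1 ?addr0 // => j /andP[_ nj].
  by rewrite (inj_eq injf) (negbTE nj) mul0r.
rewrite -cE //; apply: (ind c'); last exact: imset_f.
rewrite big_imset /=; last by move=> ? ? _ _ /injf.
by rewrite -[RHS]c0; apply: eq_bigr => l lA; rewrite cE.
Qed.

Section Jacobian.
Variable F : numFieldType.

(** [msize] is the degree plus one, and 0 for the zero polynomial; in this form degrees add without
    a special case for zero. *)
Lemma msizeM_bound N (p q : {mpoly F[N]}) a b :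
  (msize p <= a.+1)%N -> (msize q <= b.+1)%N -> (msize (p * q) <= (a + b).+1)%N.
Proof.
have [->|nzp] := eqVneq p 0; first by rewrite mul0r msize0.
have [->|nzq] := eqVneq q 0; first by rewrite mulr0 msize0.
by rewrite msizeM //; move: (msize p) (msize q) => x y; lia.
Qed.

Lemma msize_mmap1_bound k N (h : 'I_k -> {mpoly F[N]}) d (m : 'X_{1..k}) :
  (forall i, (msize (h i) <= d.+1)%N) -> (msize (mmap1 h m) <= (mdeg m * d).+1)%N.
Proof.
move=> hd; rewrite mdegE /mmap1 big_distrl /=.
elim/big_rec2: _ => [|i e p _ IH]; first by rewrite msize1.
apply: msizeM_bound IH; elim: (m i) => [|l IH]; first by rewrite expr0 msize1.
by rewrite exprS mulSn; apply: msizeM_bound.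
Qed.

Definition box_mnm k D (f : {ffun 'I_k -> 'I_D}) : 'X_{1..k} :=
  [multinom (f i : nat) | i < k].

Lemma box_mnm_inj k D : injective (@box_mnm k D).
Proof.
by move=> f g /mnmP fg; apply/ffunP => i; apply: val_inj; have := fg i; rewrite !mnmE.
Qed.

(* There are D^k monomials of degree < D in each of k variables, and only
   (k d D + 1)^N monomials can occur in their images. *)
Lemma algindep_leq k N (h : 'I_k -> {mpoly F[N]}) :
  (forall p : {mpoly F[k]}, msubst h p = 0 -> p = 0) -> (k <= N)%N.
Proof.
move=> ind; rewrite leqNgt; apply/negP => ltNk.
(* [d] bounds the degrees of the [h i], and [D'] exceeds the degree of the image of any monomial in
   the box. [D] exceeds [(k * d).+1 ^ N], so [D' ^ N <= ((k * d).+1 * D) ^ N < D ^ N.+1 <= D ^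
   k]. *)
pose d := (\sum_i msize (h i))%N; pose D := ((k * d).+1 ^ N).+1.
pose D' := (k * D * d).+1.
have hd i : (msize (h i) <= d.+1)%N by rewrite /d (bigD1 i) //=; lia.
(* Row [i] lists the coefficients of the image of the [i]-th box monomial; a vector in the left
   kernel is an algebraic relation. *)
pose Q := \matrix_(i < #|{ffun 'I_k -> 'I_D}|, j < #|{ffun 'I_N -> 'I_D'}|)
  (mmap1 h (box_mnm (enum_val i)))@_(box_mnm (enum_val j)).
have : row_free Q.
  apply: inj_row_free => y /rowP yQ.
  pose p : {mpoly F[k]} := \sum_i y 0 i *: 'X_[box_mnm (enum_val i)].
  have hp : msubst h p = \sum_i y 0 i *: mmap1 h (box_mnm (enum_val i)).
    rewrite rmorph_sum; apply: eq_bigr => i _.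
    by rewrite /= -mul_mpolyC rmorphM /= msubstC mul_mpolyC /msubst mmapX.
  have p0 : p = 0.
    apply: ind; apply/mpolyP => m; rewrite hp mcoeff0 linear_sum /=.
    have [/forallP mD|] := boolP [forall i, (m i < D')%N].
      pose g := [ffun i => Ordinal (mD i)].
      have := yQ (enum_rank g); rewrite !mxE => yg; rewrite -[RHS]yg.
      apply: eq_bigr => i _; rewrite mxE mcoeffZ enum_rankK; congr (_ * _@_ _).
      by apply/mnmP => l; rewrite mnmE ffunE.
    rewrite negb_forall => /existsP[l]; rewrite -leqNgt => ml.
    rewrite big1 // => i _; rewrite mcoeffZ [X in _ * X]memN_msupp_eq0 ?mulr0 //.
    apply: msize_mdeg_ge; apply: leq_trans (msize_mmap1_bound _ hd) _.
    have lm : (m l <= mdeg m)%N by rewrite mdegE (bigD1 l) //= leq_addr.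
    have fD : (mdeg (box_mnm (enum_val i)) <= k * D)%N.
      rewrite mdegE -[X in (X * D)%N](card_ord k) -sum_nat_const leq_sum // => j _.
      by rewrite mnmE ltnW.
    by rewrite (leq_trans _ lm) // (leq_trans _ ml) // ltnS leq_mul2r fD orbT.
  apply/rowP => i; rewrite mxE.
  have /(congr1 (mcoeff (box_mnm (enum_val i)))) := p0.
  rewrite mcoeff0 linear_sum (bigD1 i) //= mcoeffZ mcoeffX eqxx mulr1 big1 ?addr0 //.
  move=> j nj; rewrite mcoeffZ mcoeffX (inj_eq (@box_mnm_inj _ _)).
  by rewrite (inj_eq enum_val_inj) (negbTE nj) mulr0.
rewrite /row_free => /eqP rQ; have := rank_leq_col Q; rewrite rQ !card_ffun !card_ord.
apply/negP; rewrite -ltnNge.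
have le1 : (D' ^ N <= ((k * d).+1 * D) ^ N)%N.
  have [->//|N0] := posnP N.
  by rewrite leq_exp2r // /D' mulSn mulnAC -add1n leq_add2r.
apply: leq_ltn_trans le1 _; rewrite expnMn.
apply: (@leq_trans (D ^ N.+1)); last by rewrite leq_pexp2l.
by rewrite expnS ltn_pmul2r ?expn_gt0 // ltnS.
Qed.

Section Criterion.
Variables (k N : nat) (G : 'I_k -> {mpoly F[N]}).

Definition jacobian E (H : E -> {mpoly F[N]}) (j : 'I_N) (e : E) : {fraction {mpoly F[N]}} :=
  tofrac (H e)^`M(j).

(** The chain rule applied to [p(G) = 0]: the gradient of [p] evaluated at [G] is a relation between
    the Jacobian columns. *)
Lemma relation_of_poly (p : {mpoly F[k]}) : msubst G p = 0 ->
  relation (jacobian G) (fun i => tofrac (msubst G p^`M(i))).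
Proof.
move=> p0 j; have := mderiv_msubst G p j; rewrite p0 raddf0 => /esym h.
rewrite -[RHS](tofrac0 {mpoly F[N]}) -h rmorph_sum; apply: eq_bigr => i _.
by rewrite rmorphM.
Qed.

(** The partial derivatives of a relation, evaluated at [G], form a column relation supported on
    [A], hence vanish. They are thus relations of smaller size, zero by induction, so the original
    relation is a constant. *)
Lemma algindep_of_jacobian A : column_matroid (jacobian G) A -> algindep G A.
Proof.
move=> /column_matroidP indJ p; have [s] := ubnP (msize p).
elim: s p => // s IHs p ltps pA p0.
apply: contrapT => /eqP nzp.
have dp i : p^`M(i) = 0.
  apply: IHs => [|l nlA|].
  - by have := msize_mderiv i nzp; lia.
  - by rewrite mderiv_comm (pA l) // raddf0.
  have := indJ _ _ (relation_of_poly p0) i.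
  move=> h; apply/eqP; rewrite -tofrac_eq0; apply/eqP/h => l /pA->.
  by rewrite raddf0 tofrac0.
move: nzp p0; rewrite (mderiv_eq0_const dp) msubstC => nz /eqP h.
by case/eqP: nz; apply/eqP; move: h; rewrite !mpolyC_eq0.
Qed.

Lemma algindep_card A : algindep G A -> (#|A| <= N)%N.
Proof.
move=> indA; apply: (@algindep_leq _ _ (G \o enum_val)).
apply/(algindep_imset G (@enum_val_inj _ (mem A))).
rewrite (_ : _ @: _ = A) //; apply/setP => i; apply/imsetP/idP => [[a _ ->]|iA].
  exact: enum_valP.
by exists (enum_rank_in iA i); rewrite ?inE ?enum_rankK_in.
Qed.

(* When X_j is algebraic over the polynomials in a maximal independent family,
   a relation of minimal degree has nonzero derivative with respect to X_j. *)
Lemma gradient_inspan (H : {set 'I_k}) l :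
    basis (algindep G) H ->
  exists c : 'I_k -> {fraction {mpoly F[N]}},
    forall j, jacobian G j l = \sum_(i in H) c i * jacobian G j i.
Proof.
move=> [indH maxH]; have [lH|nlH] := boolP (l \in H).
  exists (fun i => (i == l)%:R) => j; rewrite (bigD1 l) //= eqxx mul1r big1 ?addr0 //.
  by move=> i /andP[_ /negbTE->]; rewrite mul0r.
pose bad p := [/\ forall i, i \notin l |: H -> p^`M(i) = 0, msubst G p = 0 & p != 0].
have [p [pH p0 nzp] minp] :
    exists2 p, bad p & forall q, bad q -> (msize p <= msize q)%N.
  have ex : exists s, `[< exists2 p, bad p & msize p = s >].
    apply: contrapT => nex; case/negP: nlH.
    suff <- : l |: H = H by rewrite setU11.
    apply: maxH (subsetUr _ _) => p pH p0; apply: contrapT => /eqP nzp.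
    by apply: nex; exists (msize p); apply/asboolP; exists p.
  case: (ex_minnP ex) => s /asboolP[p bp <-] mins; exists p => // q bq.
  by apply: mins; apply/asboolP; exists q.
pose q i := msubst G p^`M(i).
(* Otherwise the derivative in [l] is either a smaller bad polynomial, against minimality, or zero;
   in the latter case [p] does not involve [l] and contradicts the independence of [H]. *)
have nzq : q l != 0.
  apply/negP => /eqP ql0; have dl0 : p^`M(l) = 0.
    apply: contrapT => /eqP nzd.
    have /minp : bad p^`M(l).
      by split=> // i niH; rewrite mderiv_comm (pH i) // raddf0.
    by rewrite leqNgt msize_mderiv.
  case/eqP: nzp; apply: indH p0 => i niH.
  by have [->//|ni] := eqVneq i l; apply: pH; rewrite !inE negb_or ni.
exists (fun i => - (tofrac (q l))^-1 * tofrac (q i)) => j.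
have nzt : tofrac (q l) != 0 by rewrite tofrac_eq0.
apply: (mulfI nzt); have := relation_of_poly p0 j.
rewrite (bigID (mem (l |: H))) /= [X in _ + X]big1 ?addr0 => [|i /pH->]; last first.
  by rewrite raddf0 tofrac0 mul0r.
rewrite big_setU1 //= => /eqP; rewrite addr_eq0 => /eqP->.
rewrite mulr_sumr -sumrN; apply: eq_bigr => i _.
by rewrite !mulNr mulrN !mulrA mulfV // mul1r.
Qed.

(** Extend [A] to a maximal independent [H]. The gradients of all the variables, a standard basis,
    lie in the span of the gradients of [H], so these have rank [N]; as [H] has at most [N]
    elements, they are independent. *)
Lemma jacobian_of_algindep (g : 'I_N -> 'I_k) A :
    (forall j, G (g j) = 'X_j) -> algindep G A -> column_matroid (jacobian G) A.
Proof.
move=> gX /matroid_basis_sup[H bH sAH].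
have [_ sub _] := linear_matroid_is_matroid
  (fun e => [ffun t => jacobian G t e] : {ffun 'I_N -> {fraction {mpoly F[N]}}^o}).
apply: sub sAH _; apply/column_matroid_row_free.
have full : row_full (column_mx (jacobian G) H).
  have /choice[c hc] j := gradient_inspan (g j) bH.
  apply/row_fullP; exists (\matrix_(j, a) c (enum_val j) (enum_val a)).
  apply/matrixP => j t; rewrite !mxE.
  have := hc (enum_val j) (enum_val t); rewrite big_enum_val /jacobian gX mderivXU.
  rewrite rmorph_nat (inj_eq enum_val_inj) => ->.
  by apply: eq_bigr => a _; rewrite !mxE.
have /algindep_card leHN := bH.1.
move: full; rewrite /row_full /row_free => /eqP rk.
by rewrite eqn_leq rank_leq_row rk card_ord.
Qed.

End Criterion.

Lemma jacobian_criterion (E : finType) N (G : E -> {mpoly F[N]}) (A : {set E}) :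
  (forall p : {mpoly F[#|A|]}, msubst (fun k => G (enum_val k)) p = 0 -> p = 0) <->
  column_matroid (jacobian G) A.
Proof.
(* Adjoining the variables to the family makes every maximal independent set have gradients of full
   rank; independence inside the original family is unaffected. *)
pose G' (i : 'I_(#|E| + N)) : {mpoly F[N]} :=
  match split i with inl a => G (enum_val a) | inr j => 'X_j end.
pose f e : 'I_(#|E| + N) := lshift N (enum_rank e).
have injf : injective f by move=> e e' /lshift_inj/enum_rank_inj.
have G'f e : G' (f e) = G e by rewrite /G' /f (unsplitK (inl _)) enum_rankK.
have injh : injective (fun k : 'I_#|A| => f (enum_val k)) by move=> a b /injf/enum_val_inj.
have fA : (fun k : 'I_#|A| => f (enum_val k)) @: setT = f @: A.
  apply/setP => i; apply/imsetP/imsetP => -[a aA ->].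
    by exists (enum_val a) => //; apply: enum_valP.
  by exists (enum_rank_in aA a); rewrite ?inE ?enum_rankK_in.
have -> : (forall p : {mpoly F[#|A|]}, msubst (fun k => G (enum_val k)) p = 0 -> p = 0)
    <-> algindep G' (f @: A).
  rewrite -fA -(algindep_imset G' injh); split=> ind p p0; apply: ind;
    by rewrite -[RHS]p0; apply: eq_msubst => a /=; rewrite G'f.
have -> : column_matroid (jacobian G) A <-> column_matroid (jacobian G') (f @: A).
  rewrite /column_matroid -(linear_matroid_imset _ _ injf).
  rewrite (_ : _ \o f = fun e => [ffun t => jacobian G t e]) //.
  by apply/funext => e; apply/ffunP => t; rewrite !ffunE /jacobian G'f.
split; last exact: algindep_of_jacobian.
apply: (@jacobian_of_algindep _ _ _ (@rshift _ _)) => j.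
by rewrite /G' (unsplitK (inr _)).
Qed.

End Jacobian.

(** * Symmetric completion *)

Lemma column_matroid_rows (K : fieldType) (S T E : finType) (M : S -> E -> K) (f : T -> S) :
  bijective f -> column_matroid (fun t e => M (f t) e) = column_matroid M.
Proof.
move=> [g fg gf]; apply/funext => A; apply/propext; rewrite !column_matroidP.
by split=> ind c cA rc; apply: ind => // t; rewrite -1?[t]gf rc.
Qed.

Section Completion.
Variables (R : realType) (n d : nat).
Local Notation C := R[i].

Definition gram_entry (e : pairs n + 'I_n) : {mpoly C[n * d]} :=
  \sum_(k < d) 'X_(mxvec_index (ends e).1 k) * 'X_(mxvec_index (ends e).2 k).

Definition gram_point (v : 'I_(n * d) -> C) : 'M[C]_n :=
  let Y := \matrix_(i < n, k < d) v (mxvec_index i k) in Y *m Y^T.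

Lemma meval_gram_entry v e :
  (gram_entry e).@[v] = gram_point v (ends e).1 (ends e).2.
Proof.
rewrite /gram_entry rmorph_sum mxE; apply: eq_bigr => k _.
by rewrite rmorphM /= !mevalXU !mxE.
Qed.

(** Over the complex numbers the symmetric matrices of rank at most [d] are exactly the products of
    an [n] by [d] matrix with its transpose. *)
Lemma restrict_eq0 (q : {mpoly C[n * n]}) :
  restrict_to_variety d q = 0 <-> forall v, eval_mx (gram_point v) q = 0.
Proof.
have -> : restrict_to_variety d q = 0 <-> forall M, sym_variety d M -> eval_mx M q = 0.
  transitivity (q \in @sym_ideal R n d); last by split=> /asboolP.
  rewrite /restrict_to_variety; split=> [/eqP|h].
    rewrite tofrac_eq0 => /eqP h.
    rewrite -[q]subr0 Quotient.idealrBE; apply/eqP; rewrite h.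
    by rewrite raddf0.
  apply/eqP; rewrite tofrac_eq0; apply/eqP.
  rewrite -[q]subr0 Quotient.idealrBE in h. move/eqP: h => ->.
  by rewrite raddf0.
split=> [h v|h M /sym_varietyP[Y ->]].
  apply: h; split; first by rewrite trmx_mul trmxK.
  by rewrite (leq_trans (mxrankM_maxl _ _)) ?rank_leq_col.
rewrite -(h (mxvec Y 0)) /gram_point; congr (eval_mx (_ *m _^T) _);
  by apply/matrixP => i k; rewrite !mxE mxvecE.
Qed.


Lemma sym_completion_gram :
  @sym_completion_matroid R n d =
  column_matroid (gram_columns (fun p : 'I_n * 'I_d => hyper_var R p.1 p.2)).
Proof.
pose idx (e : pairs n + 'I_n) := mxvec_index (ends e).1 (ends e).2.
pose F : {rmorphism {mpoly C[n * n]} -> sym_function_field R n d} :=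
  @tofrac (sym_coordinate_ring R n d) \o \pi_(sym_coordinate_ring R n d)%qT.
have substE k (e : 'I_k -> pairs n + 'I_n) (p : {mpoly C[k]}) :
    mmap (fun c : C => restrict_to_variety d c%:MP)
      (fun k => coordinate_function R d (e k)) p =
    restrict_to_variety d (msubst (fun k => 'X_(idx (e k))) p).
  rewrite -[RHS]/(F _) /msubst rmorph_mmap; apply: eq_mmap => [//|l /=].
  by rewrite /idx /coordinate_function; case: (e l) => [f|i].
(* A relation among coordinate functions holds at every Gram point, and a polynomial vanishing at
   all points is zero; so it is a relation among the Gram entries as polynomials. *)
have mvE k (e : 'I_k -> pairs n + 'I_n) (p : {mpoly C[k]}) :
    restrict_to_variety d (msubst (fun k => 'X_(idx (e k))) p) = 0 <->
    msubst (fun k => gram_entry (e k)) p = 0.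
  rewrite restrict_eq0; split=> [h|h v].
    apply: meval_eq0 => v; rewrite -[RHS](h v) /eval_mx !msubst_meval.
    by apply: meval_eq => l; rewrite meval_gram_entry mevalXU mxvecE.
  rewrite -[RHS](meval0 v) -h /eval_mx !msubst_meval.
  by apply: meval_eq => l; rewrite meval_gram_entry mevalXU mxvecE.
have -> : sym_completion_matroid R d = column_matroid (jacobian gram_entry).
  apply/funext => A; apply/propext; rewrite -jacobian_criterion.
  split=> ind p.
    by move=> p0; apply: ind; rewrite substE; apply/mvE.
  by rewrite substE => /mvE; apply: ind.
have bij : bijective (uncurry (@mxvec_index n d)) := onT_bij (curry_mxvec_bij n d).
rewrite -(column_matroid_rows _ bij); congr column_matroid.
apply/funext => -[p q]; apply/funext => e; rewrite /jacobian /gram_columns /=.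
have idxE i k : (mxvec_index i k == mxvec_index p q) = (p == i) && (q == k).
  by rewrite (inj_eq (bij_inj bij) (i, k) (p, q)) xpair_eqE eq_sym [k == q]eq_sym.
rewrite /gram_entry /hyper_var linear_sum rmorph_sum /=.
under eq_bigr => k _ do rewrite mderivM !mderivXU !idxE rmorphD !rmorphM !rmorph_nat /=.
rewrite (bigD1 q) //= eqxx !andbT big1 ?addr0 => [|k nk]; first by rewrite [X in _ + X]mulrC.
by rewrite [q == k]eq_sym (negbTE nk) !andbF mul0r mulr0 addr0.
Qed.

End Completion.

(** * From products of vectors to matrices *)

Section Encodings.
Variable K : fieldType.

Lemma tensor_matroidE m n s r (u : 'I_m -> 'rV[K]_s) (v : 'I_n -> 'rV[K]_r) :
  tensor_matroid u v = column_matroid (tensor_columns (coords2 u v)).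
Proof.
rewrite /tensor_matroid matrix_column_matroid; congr column_matroid.
by apply/funext => t; apply/funext => e; rewrite mxE big_ord1 mxE.
Qed.

Lemma wedge_matroidE n r (v : 'I_n -> 'rV[K]_r) :
  wedge_matroid v = column_matroid (wedge_columns (coords v)).
Proof.
rewrite /wedge_matroid matrix_column_matroid; congr column_matroid.
by apply/funext => t; apply/funext => e; rewrite !mxE !big_ord1 !mxE.
Qed.

(* S |-> sum S_kl X_k X_l; composed with u v |-> u^T v + v^T u it gives twice
   the product of linear forms, while the Hessian goes back. *)
Definition quadratic_form r (S : 'M[K]_r) : {mpoly K[r]} :=
  \sum_k \sum_l S k l *: ('X_k * 'X_l).

Lemma quadratic_form_linear r : linear (@quadratic_form r).
Proof.
move=> a S T; rewrite /quadratic_form scaler_sumr -big_split; apply: eq_bigr => k _.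
rewrite scaler_sumr -big_split; apply: eq_bigr => l _.
by rewrite !mxE scalerDl scalerA.
Qed.

HB.instance Definition _ r := GRing.isLinear.Build K 'M[K]_r {mpoly K[r]} _
  (@quadratic_form r) (@quadratic_form_linear r).

Lemma quadratic_form_tensor r (u v : 'rV[K]_r) :
  quadratic_form (tensor u v) = linform u * linform v.
Proof.
rewrite /quadratic_form /linform mulr_suml; apply: eq_bigr => k _.
rewrite mulr_sumr; apply: eq_bigr => l _.
by rewrite mxE big_ord1 mxE -scalerAl -scalerAr scalerA.
Qed.

Lemma quadratic_form_sym r (u v : 'rV[K]_r) :
  quadratic_form (tensor u v + tensor v u) = 2%:R *: (linform u * linform v).
Proof.
by rewrite linearD /= !quadratic_form_tensor [X in _ + X]mulrC scaler_nat mulr2n.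
Qed.

(** Second derivatives at the origin, which determine a quadratic form when 2 is invertible. *)
Definition hessian r (p : {mpoly K[r]}) : 'M[K]_r :=
  \matrix_(k, l) (p^`M(k)^`M(l))@_0.

Lemma hessian_linear r : linear (@hessian r).
Proof.
by move=> a p q; apply/matrixP => k l; rewrite !mxE !linearP.
Qed.

HB.instance Definition _ r := GRing.isLinear.Build K {mpoly K[r]} 'M[K]_r _
  (@hessian r) (@hessian_linear r).

Lemma mderiv_linform r (u : 'rV[K]_r) k : (linform u)^`M(k) = (u 0 k)%:MP.
Proof.
rewrite /linform linear_sum (bigD1 k) //= big1 ?addr0 => [|l nl].
  by rewrite linearZ /= mderivXU eqxx -mul_mpolyC mulr1.
by rewrite linearZ /= mderivXU (negbTE nl) scaler0.
Qed.

Lemma hessian_linform r (u v : 'rV[K]_r) :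
  hessian (linform u * linform v) = tensor u v + tensor v u.
Proof.
apply/matrixP => k l; rewrite !mxE !big_ord1 !mxE mderivM mderivD !mderivM.
rewrite !mderiv_linform !mderivC mul0r mulr0 add0r addr0.
by rewrite -!mpolyCM -mpolyCD mcoeffC eqxx mulr1 [X in _ + X]mulrC.
Qed.

Lemma sym_matroidE n r (v : 'I_n -> 'rV[K]_r) : 2%:R != 0 :> K ->
  sym_matroid v = column_matroid (sym_columns (coords v)).
Proof.
move=> nz2; pose x e := v (ends e).1; pose y e := v (ends e).2.
have -> : sym_matroid v = linear_matroid (fun e => linform (x e) * linform (y e)).
  rewrite /sym_matroid; congr linear_matroid.
  by apply/funext => -[e|i]; rewrite /x /y //= expr2.
have -> : column_matroid (sym_columns (coords v)) =
    linear_matroid (fun e => tensor (x e) (y e) + tensor (y e) (x e)).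
  rewrite matrix_column_matroid; congr column_matroid.
  by apply/funext => t; apply/funext => e; rewrite !mxE !big_ord1 !mxE.
apply/funext => A; apply/propext; split=> ind c c0; apply: ind.
  have := congr1 (@quadratic_form r) c0; rewrite linear_sum linear0 /= => h.
  apply: (scalerI nz2); rewrite scaler0 -[RHS]h scaler_sumr; apply: eq_bigr => e _.
  transitivity (c e *: quadratic_form (tensor (x e) (y e) + tensor (y e) (x e))).
    by rewrite quadratic_form_sym !scalerA mulrC.
  exact/esym/linearZ_LR.
have := congr1 (@hessian r) c0; rewrite linear_sum linear0 /= => h.
rewrite -[RHS]h; apply: eq_bigr => e _.
by rewrite linearZ /= hessian_linform.
Qed.

End Encodings.

(** * Generic variables of the rigidity matrices *)

Section Rigidity.
Variable R : realType.

Lemma hyperconnectivity_columns n d :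
  @hyperconnectivity_matroid R n d =
  column_matroid (hyper_columns (fun p : 'I_n * 'I_d => hyper_var R p.1 p.2)).
Proof.
congr column_matroid; apply/funext => -[i j]; apply/funext => e.
by rewrite /hyper_matrix /hyper_columns; case: (val e).
Qed.

Definition birigid_var m n a b (t : 'I_m * 'I_a + 'I_n * 'I_b) : birigid_field R m n a b :=
  match t with
  | inl p => birigid_x R n b p.1 p.2
  | inr p => birigid_y R m a p.1 p.2
  end.

Lemma birigidity_columns m n a b :
  @birigidity_matroid R m n a b = column_matroid (birigid_columns (@birigid_var m n a b)).
Proof.
by congr column_matroid; apply/funext => -[[j k]|[l i]]; apply/funext.
Qed.

Lemma mxvec_index_inj m n : injective (fun p : 'I_m * 'I_n => mxvec_index p.1 p.2).
Proof.
have inj := bij_inj (onT_bij (curry_mxvec_bij m n)).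
by move=> [i j] [k l]; apply: (inj (i, j) (k, l)).
Qed.

Lemma generic_hyper_var n d :
  generic_over_rat (fun p : 'I_n * 'I_d => hyper_var R p.1 p.2).
Proof. exact: (generic_tofrac_vars (R := R) (@mxvec_index_inj n d)). Qed.

Lemma generic_birigid_var m n a b : generic_over_rat (@birigid_var m n a b).
Proof.
pose g (t : 'I_m * 'I_a + 'I_n * 'I_b) : 'I_(m * a + n * b) :=
  match t with
  | inl p => lshift _ (mxvec_index p.1 p.2)
  | inr p => rshift _ (mxvec_index p.1 p.2)
  end.
have injg : injective g.
  move=> [p|p] [q|q] /eqP; rewrite /g ?eq_lrshift ?eq_rlshift //.
    by rewrite eq_lshift => /eqP/(@mxvec_index_inj m a) ->.
  by rewrite eq_rshift => /eqP/(@mxvec_index_inj n b) ->.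
rewrite (_ : @birigid_var m n a b = fun t => tofrac 'X_(g t)).
  exact: generic_tofrac_vars.
by apply/funext => -[p|p].
Qed.

End Rigidity.

Theorem theorem1p1 (R : realType) (K : fieldType) (charK : [pchar K] =i pred0) :
  [/\ forall (n d : nat) (v : 'I_n -> 'rV[K]_(n - d)),
        (d <= n)%N -> generic_over_rat (coords v) ->
        dual_matroids (sym_matroid v) (@sym_completion_matroid R n d),
      forall (n d : nat) (v : 'I_n -> 'rV[K]_(n - d)),
        (d <= n)%N -> generic_over_rat (coords v) ->
        dual_matroids (wedge_matroid v) (@hyperconnectivity_matroid R n d) &
      forall (m n a b : nat) (u : 'I_m -> 'rV[K]_(m - a))
          (v : 'I_n -> 'rV[K]_(n - b)),
        (a <= m)%N -> (b <= n)%N -> generic_over_rat (coords2 u v) ->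
        dual_matroids (tensor_matroid u v) (@birigidity_matroid R m n a b)].
Proof.
have nz2K : 2%:R != 0 :> K.
  by apply/negP => two0; have := charK 2; rewrite !inE two0.
have nz2L N : 2%:R != 0 :> {fraction {mpoly R[i][N]}}.
  rewrite -(rmorph_nat (@tofrac {mpoly R[i][N]})) tofrac_eq0.
  by rewrite -(rmorph_nat (@mpolyC N R[i])) mpolyC_eq0 pnatr_eq0.
split.
- move=> n d v ledn gv; rewrite sym_completion_gram (sym_matroidE v nz2K).
  exact: (sym_gram_dual nz2K (nz2L _) (subnK ledn) gv (@generic_hyper_var R n d)).
- move=> n d v ledn gv; rewrite hyperconnectivity_columns wedge_matroidE.
  exact: (wedge_hyperconnectivity_dual nz2K (nz2L _) (subnK ledn) gv (@generic_hyper_var R n d)).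
move=> m n a b u v leam lebn guv; rewrite birigidity_columns tensor_matroidE.
exact: (tensor_birigidity_dual (subnK leam) (subnK lebn) guv (@generic_birigid_var R m n a b)).
Qed.
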